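(* Let $\eta$ be a random variable taking values in $\{0,1,2,\dots\}\cup\{\infty\}$ with $P(\eta=0)<1$, let $\alpha>0$, and let $p_n=(1-\frac{\alpha}{\log n})^+$, where $x^+=\max\{0,x\}$. (i) If $\alpha>E(\eta)$, then $\lim_{n\to\infty}P(V_\infty(\mathcal{K}_n,p_n)=n)=0$. (ii) If $0<\alpha<E(\eta)$, then $\lim_{n\to\infty}P(V_\infty(\mathcal{K}_n,p_n)=n)=1$ (in particular, if $E(\eta)=\infty$ this holds for every $\alpha>0$).
   Context: Frog model on the complete graph: $\mathcal{K}_n=(\mathcal{V}_n,\mathcal{E}_n)$ is the complete graph on $n$ vertices, with a distinguished vertex $o$ called the root. Let $\{\eta_v\}_{v\in\mathcal{V}_n}$ be i.i.d. copies of $\eta$. Initially each vertex $v\neq o$ carries $\eta_v$ inactive particles and $o$ carries $1+\eta_o$ active particles. At each instant of time, independently of everything else, each active particle survives with probability $p$ and otherwise dies (is permanently removed); a surviving active particle performs one step of simple random walk on $\mathcal{K}_n$ (jumps to a uniformly chosen vertex different from its current one), activating all inactive particles at the vertex it reaches. Inactive particles stay put until activated. A vertex is visited if some active particle is ever at it (the root is visited). $V_\infty(\mathcal{K}_n,p)$ is the total number of visited vertices once no active particles remain; in the cases $P(\eta=\infty)>0$ or $p=1$ one sets $V_\infty(\mathcal{K}_n,p):=n$. *)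

(* Defs.v *)
From HB Require Import structures.
From mathcomp Require Import all_boot all_order all_algebra.
From mathcomp Require Import all_classical all_reals all_analysis.
Set Implicit Arguments. Unset Strict Implicit. Unset Printing Implicit Defensive.
Import Order.TTheory GRing.Theory Num.Theory.
Local Open Scope ring_scope.


(* Law of eta: q : option nat -> R, with q (Some k) = P(eta = k) and
   q None = P(eta = infinity). *)
Definition is_eta_law (R : realType) (q : option nat -> R) : Prop :=
  (forall x, 0 <= q x) /\
  ((q None)%:E + \sum_(0 <= k <oo) (q (Some k))%:E = 1)%E.

Definition eta_mean (R : realType) (q : option nat -> R) : \bar R :=
  if 0 < q None then +oo%E
  else (\sum_(0 <= k <oo) ((k%:R * q (Some k))%:E))%E.

(* ---------- frog model on the complete graph K_{n+1}, vertices 'I_n.+1,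
   root ord0, given a (finite) configuration f of initial particle counts. *)

(* one-step move of a single active particle at v: None = dies,
   Some w = jumps to w (uniform among the n other vertices). *)
Definition move_prob (R : realType) (n : nat) (p : R) (v : 'I_n.+1)
  (o : option 'I_n.+1) : R :=
  match o with
  | None => 1 - p
  | Some w => if w == v then 0 else p / n%:R
  end.

Definition next_visited (n : nat) (S : {set 'I_n.+1}) (o : seq (option 'I_n.+1))
  : {set 'I_n.+1} :=
  S :|: [set w in pmap id o].

Definition next_active (n : nat) (f : 'I_n.+1 -> nat) (S : {set 'I_n.+1})
  (o : seq (option 'I_n.+1)) : seq 'I_n.+1 :=
  pmap id o ++
  flatten [seq nseq (f w) w | w <- enum [set w in pmap id o | w \notin S]].

Fixpoint cover_within (R : realType) (n : nat) (p : R) (f : 'I_n.+1 -> nat)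
  (t : nat) (S : {set 'I_n.+1}) (l : seq 'I_n.+1) : R :=
  match t with
  | 0 => (S == [set: 'I_n.+1])%:R
  | t'.+1 =>
    if S == [set: 'I_n.+1] then 1 else
    \sum_(o : (size l).-tuple (option 'I_n.+1))
      (\prod_(i < size l) move_prob p (nth ord0 l i) (tnth o i)) *
      cover_within p f t' (next_visited S o) (next_active f S o)
  end.

Definition cover_prob (R : realType) (n : nat) (p : R) (f : {ffun 'I_n.+1 -> nat})
  : R :=
  sup (range (fun t => cover_within p f t [set ord0] (nseq (1 + f ord0) ord0))).

Definition all_visited_prob_S (R : realType) (q : option nat -> R) (n : nat) (p : R)
  : R :=
  if (0 < q None) || (p == 1) then 1 else
  fine (\esum_(f in [set: {ffun 'I_n.+1 -> nat}]%classic)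
          ((\prod_(v < n.+1) q (Some (f v))) * cover_prob p f)%:E).

(* P(V_infty(K_n, p) = n), n >= 1 (value at n = 0 is irrelevant) *)
Definition all_visited_prob (R : realType) (q : option nat -> R) (n : nat) (p : R)
  : R :=
  match n with 0 => 1 | n'.+1 => all_visited_prob_S q n' p end.

Definition p_seq (R : realType) (alpha : R) (n : nat) : R :=
  Num.max 0 (1 - alpha / ln (n%:R)).

(* Main.v *)
(** The one-step expectation is applied to potentials [h (S, l)] of the visited
    set [S] and the list [l] of active particles.  Let [x] be such that a
    particle avoids [k] given vertices for its whole life with probability
    [1 / (1 + k x)], and let the mass be the number of particles alive, active
    or not.  For every set [U] of vertices,
    [escape U = [U and S disjoint] (1 + #|U| x) ^ (- mass)] is harmonic: a
    particle sitting in [U] cannot move before [U] is hit.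

    Subcritical case: with [X] the sum of the [escape {v}] and [Z] the sum of the
    [escape {v, w}], the potential [1 - 2 a X + a^2 Z] is nonnegative and equals
    1 at full coverage; optimizing in [a] gives a second moment bound on the
    probability of coverage, small as soon as the number of particles is at most
    [C n] with [C < alpha].  The latter holds with high probability by a weak law
    of large numbers, proved with Laplace transforms so that only expectations of
    products over the vertices are needed.

    Supercritical case: if the process dies leaving [U] unvisited, [escape U]
    ends at an explicit value, whence the probability of this is at most
    [(1 + #|U| x) ^ (- sum of f outside U)].  Summing over [U] works provided a
    positive proportion of the vertices with particles lies outside [U]; an early
    extinction before such a proportion is visited is excluded by the
    supermartingale [th ^ (number of active particles)]. *)

Require Import Defs.
From HB Require Import structures.
From mathcomp Require Import all_boot all_order all_algebra.
From mathcomp Require Import all_classical all_reals all_analysis.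
From mathcomp Require Import ring lra zify.
Import Order.TTheory GRing.Theory Num.Theory.
Local Open Scope ring_scope.
Import numFieldNormedType.Exports.
Set Implicit Arguments. Unset Strict Implicit. Unset Printing Implicit Defensive.

(** * One-step expectation as an iterated sum over the active particles *)

Fixpoint step_mean (R : realType) (n : nat) (p : R) (l : seq 'I_n.+1)
    (F : seq (option 'I_n.+1) -> R) : R :=
  if l is v :: l' then
    \sum_(y : option 'I_n.+1) move_prob p v y * step_mean p l' (fun o => F (y :: o))
  else F [::].

Section StepMean.
Variables (R : realType) (n : nat) (p : R).
Hypotheses (p0 : 0 <= p) (p1 : p <= 1).
Implicit Types (l : seq 'I_n.+1) (F G : seq (option 'I_n.+1) -> R).

Lemma big_tuple_cons (T : finType) (m : nat) (H : m.+1.-tuple T -> R) :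
  \sum_(z : m.+1.-tuple T) H z =
  \sum_(y : T) \sum_(z : m.-tuple T) H (cons_tuple y z).
Proof.
rewrite pair_big /= (reindex (fun yo : T * m.-tuple T => cons_tuple yo.1 yo.2)) //=.
exists (fun z => (thead z, behead_tuple z)) => [[y z] _|z _] /=.
  by congr pair; apply/val_inj.
by rewrite [RHS]tuple_eta.
Qed.

Lemma step_mean_cons v l F :
  step_mean p (v :: l) F =
  \sum_y move_prob p v y * step_mean p l (fun o => F (y :: o)).
Proof. by []. Qed.

(** Turns the tuple sum of [cover_within] into an iterated one, so that one-step facts follow by
    induction on the active list. *)
Lemma step_mean_tuple l F :
  \sum_(o : (size l).-tuple (option 'I_n.+1))
    (\prod_(i < size l) move_prob p (nth ord0 l i) (tnth o i)) * F o =
  step_mean p l F.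
Proof.
elim: l F => [|v l IH] F /=.
  rewrite (big_pred1 (nil_tuple _)) => [|o]; first by rewrite big_ord0 mul1r.
  by rewrite (tuple0 o) /=; apply/esym/eqP/val_inj.
rewrite big_tuple_cons; apply: eq_bigr => y _.
rewrite -IH big_distrr /=; apply: eq_bigr => o _.
rewrite big_ord_recl /= -mulrA tnth0; congr (_ * (_ * _)).
by apply: eq_bigr => i _; rewrite tnthS.
Qed.

Lemma move_prob_ge0 (v : 'I_n.+1) y : 0 <= move_prob p v y.
Proof.
case: y => [w|] /=; last by rewrite subr_ge0.
by case: ifP => // _; rewrite divr_ge0.
Qed.

Lemma sum_move_prob (v : 'I_n.+1) (g : option 'I_n.+1 -> R) :
  \sum_y move_prob p v y * g y =
  (1 - p) * g None + p / n%:R * \sum_(w | w != v) g (Some w).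
Proof.
rewrite [LHS](bigD1 None) //=; congr (_ + _).
rewrite (reindex_omap Some id) => [|[w|]] //=.
rewrite big_distrr /= [RHS]big_mkcond /=.
apply: eq_big => [w|w _]; first by rewrite eqxx.
by case: eqP => // _; rewrite mul0r.
Qed.

Lemma eq_step_mean l F G : (forall o, F o = G o) -> step_mean p l F = step_mean p l G.
Proof.
elim: l F G => [|v l IH] F G FG /=; first exact: FG.
by apply: eq_bigr => y _; congr (_ * _); apply: IH => o.
Qed.

Lemma le_step_mean l F G : (forall o, F o <= G o) -> step_mean p l F <= step_mean p l G.
Proof.
elim: l F G => [|v l IH] F G FG /=; first exact: FG.
by apply: ler_sum => y _; apply: ler_wpM2l; [exact: move_prob_ge0|exact: IH].
Qed.

Lemma step_meanD l F G :
  step_mean p l (fun o => F o + G o) = step_mean p l F + step_mean p l G.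
Proof.
elim: l F G => [//|v l IH] F G /=.
by rewrite -big_split; apply: eq_bigr => y _; rewrite IH mulrDr.
Qed.

Lemma step_meanZ l a F : step_mean p l (fun o => a * F o) = a * step_mean p l F.
Proof.
elim: l F => [//|v l IH] F /=.
by rewrite big_distrr /=; apply: eq_bigr => y _; rewrite IH mulrCA.
Qed.

Lemma step_meanN l F : step_mean p l (fun o => - F o) = - step_mean p l F.
Proof.
by rewrite -mulN1r -step_meanZ; apply: eq_step_mean => o; rewrite mulN1r.
Qed.

Lemma step_mean0 l : step_mean p l (fun=> 0) = 0.
Proof.
by elim: l => [//|v l IH] /=; rewrite big1 // => y _; rewrite IH mulr0.
Qed.

Lemma step_mean_sum (I : Type) (r : seq I) (P : pred I) l
    (H : I -> seq (option 'I_n.+1) -> R) :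
  step_mean p l (fun o => \sum_(i <- r | P i) H i o) =
  \sum_(i <- r | P i) step_mean p l (H i).
Proof.
elim: r => [|i r IH].
  by rewrite big_nil -[RHS](step_mean0 l); apply: eq_step_mean => o; rewrite big_nil.
rewrite big_cons -IH; case: ifP => Pi; first rewrite -step_meanD;
  by apply: eq_step_mean => o; rewrite big_cons Pi.
Qed.

(** The particles move independently; the survival and escape computations below rest on this. *)
Lemma step_mean_prod l g :
  step_mean p l (fun o => \prod_(y <- o) g y) =
  \prod_(v <- l) \sum_y move_prob p v y * g y.
Proof.
elim: l => [|v l IH] /=; first by rewrite !big_nil.
rewrite big_cons -IH big_distrl /=; apply: eq_bigr => y _.
rewrite -mulrA; congr (_ * _); rewrite -step_meanZ.
by apply: eq_step_mean => o; rewrite big_cons.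
Qed.

(** The condition [0 < n] matters: with a single vertex there is nowhere to jump and the weights
    only sum to [1 - p]. *)
Lemma step_mean1 l : (0 < n)%N -> step_mean p l (fun=> 1) = 1.
Proof.
move=> n0; elim: l => [//|v l IH] /=.
under eq_bigr do rewrite IH.
rewrite (sum_move_prob v (fun=> 1)) sumr_const cardC1 card_ord mulr1 divfK ?subrK //.
by rewrite pnatr_eq0 -lt0n.
Qed.

Lemma cover_withinS f t (S : {set 'I_n.+1}) l :
  cover_within p f t.+1 S l =
  if S == [set: 'I_n.+1]%SET then 1 else
  step_mean p l (fun o => cover_within p f t (next_visited S o) (next_active f S o)).
Proof. by rewrite -step_mean_tuple. Qed.

End StepMean.

(** * Mass, visited set and active list after one step *)

Definition mass (n : nat) (f : 'I_n.+1 -> nat) (S : {set 'I_n.+1})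
    (l : seq 'I_n.+1) : nat :=
  (size l + \sum_(v | v \notin S) f v)%N.

Section State.
Variables (n : nat) (f : 'I_n.+1 -> nat).
Implicit Types (S : {set 'I_n.+1}) (l : seq 'I_n.+1) (o : seq (option 'I_n.+1)).

Lemma size_next_active S o :
  size (next_active f S o) =
  (size (pmap id o) + \sum_(v | (v \in pmap id o) && (v \notin S)) f v)%N.
Proof.
rewrite size_cat size_flatten /shape -map_comp sumnE big_map big_enum /=.
by congr addn; apply: eq_big => [v|v _]; rewrite ?inE //= size_nseq.
Qed.

(** Waking only moves particles from the dormant sum to the active list, so deaths alone change the
    mass, whatever vertices are reached. *)
Lemma mass_next S o :
  mass f (next_visited S o) (next_active f S o) =
  (size (pmap id o) + \sum_(v | v \notin S) f v)%N.
Proof.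
rewrite /mass size_next_active -addnA; congr addn.
rewrite [RHS](bigID (fun v => v \in pmap id o)) /=.
by congr addn; apply: eq_bigl => v; rewrite ?inE ?negb_or andbC.
Qed.

Lemma next_active_sub S l o : {subset l <= S} ->
  {subset next_active f S o <= next_visited S o}.
Proof.
move=> lS v; rewrite mem_cat !inE => /orP[->|]; first exact: orbT.
case/flattenP => s /mapP[w]; rewrite mem_enum inE => /andP[wo _] ->.
by rewrite mem_nseq => /andP[_ /eqP->]; rewrite wo orbT.
Qed.

Lemma next_visited_cons S y o :
  next_visited S (y :: o) = next_visited (next_visited S [:: y]) o.
Proof.
by apply/setP => v; rewrite !inE; case: y => [w|] /=; rewrite !inE ?orbF ?orbA.
Qed.

Lemma next_visited_nil S : next_visited S [::] = S.
Proof. by apply/setP => v; rewrite !inE orbF. Qed.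

(** Writes avoidance of [U] as a condition on each particle separately, the form that
    [step_mean_prod] needs. *)
Lemma disjoint_next (U : {set 'I_n.+1}) S o :
  [disjoint U & next_visited S o] =
  [disjoint U & S] && all (fun y => if y is Some w then w \notin U else true) o.
Proof.
elim: o S => [|y o IH] S; first by rewrite next_visited_nil andbT.
rewrite next_visited_cons IH /= andbA; congr (_ && _).
rewrite -!finset.setI_eq0 /next_visited finset.setIUr finset.setU_eq0; congr (_ && _).
case: y => [w|] /=; last by apply/eqP/setP => v; rewrite !inE andbF.
apply/eqP/idP => [/setP/(_ w)|wU]; first by rewrite !inE eqxx andbT => ->.
by apply/setP => v; rewrite !inE; case: eqP => [->|]; rewrite ?(negbTE wU) ?andbF.
Qed.

End State.

(** * Comparison of coverage probabilities with superharmonic potentials *)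

Section Comparison.
Variables (R : realType) (n : nat) (p : R) (f : 'I_n.+1 -> nat).
Hypotheses (n0 : (0 < n)%N) (p0 : 0 <= p) (p1 : p < 1).
Implicit Types (h : {set 'I_n.+1} -> seq 'I_n.+1 -> R) (S : {set 'I_n.+1}) (l : seq 'I_n.+1).

(** Required only when active particles stand on visited vertices, an invariant of the dynamics by
    [next_active_sub]; [escape] need not be harmonic otherwise. *)
Definition superharmonic h := forall (S : {set 'I_n.+1}) (l : seq 'I_n.+1), {subset l <= S} ->
  step_mean p l (fun o => h (next_visited S o) (next_active f S o)) <= h S l.

Let p1' : p <= 1 := ltW p1.

(** Optional stopping at full coverage, by induction on the time horizon. *)
Lemma cover_within_le h :
  (forall S l, 0 <= h S l) -> (forall l, 1 <= h [set: 'I_n.+1]%SET l) ->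
  superharmonic h ->
  forall t (S : {set 'I_n.+1}) (l : seq 'I_n.+1), {subset l <= S} ->
  cover_within p f t S l <= h S l.
Proof.
move=> h0 h1 hs; elim=> [|t IH] S l lS.
  by rewrite /=; case: eqP => [->|_]; [exact: h1|exact: h0].
rewrite cover_withinS //; case: eqP => [->|_]; first exact: h1.
apply: le_trans (hs S l lS); apply: le_step_mean => // o.
by apply: IH; exact: next_active_sub lS.
Qed.

Lemma cover_within_ge0 t S l : 0 <= cover_within p f t S l.
Proof.
elim: t S l => [|t IH] S l; first exact: ler0n.
rewrite cover_withinS //; case: ifP => _; first exact: ler01.
rewrite -(step_mean0 (n := n) p l).
exact: le_step_mean.
Qed.

Lemma cover_within_le1 t S l : cover_within p f t S l <= 1.
Proof.
elim: t S l => [|t IH] S l; first by rewrite /= lern1 leq_b1.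
rewrite cover_withinS //; case: ifP => _; first exact: lexx.
by rewrite -[leRHS](step_mean1 (n := n) p l n0); exact: le_step_mean.
Qed.

(** By [mass_next] only the number of survivors is random, and it is binomial. *)
Lemma step_mean_surv (z : R) S l :
  step_mean p l (fun o => z ^+ mass f (next_visited S o) (next_active f S o)) =
  z ^+ (\sum_(v | v \notin S) f v)%N * (1 - p + p * z) ^+ size l.
Proof.
under eq_step_mean => o.
  rewrite mass_next addnC exprD.
  over.
rewrite step_meanZ; congr (_ * _).
transitivity (step_mean p l (fun o => \prod_(y <- o) (if y is Some _ then z else 1))).
  apply: eq_step_mean => o; elim: o => [|[w|] o IH] /=; rewrite ?big_nil ?big_cons //=.
    by rewrite exprS IH.
  by rewrite mul1r IH.
rewrite step_mean_prod.
under eq_bigr => v _.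
  rewrite sum_move_prob // mulr1 sumr_const cardC1 card_ord /= -[z *+ n]mulr_natl mulrA.
  rewrite divfK; last by rewrite pnatr_eq0 -lt0n.
  over.
by rewrite big_const_seq count_predT -[LHS]/(iter _ _ _) -[RHS]mulr1 -iter_mulr.
Qed.

(* The last term bounds the probability that a particle is still active at time
   [t]: while one is, [2 ^ mass] shrinks on average by [(1 + p) / 2] per step. *)
Lemma cover_within_ge h :
  (forall S l, 0 <= h S l) -> (forall S, S != [set: 'I_n.+1]%SET -> 1 <= h S [::]) ->
  superharmonic h ->
  forall t (S : {set 'I_n.+1}) (l : seq 'I_n.+1), {subset l <= S} ->
  1 - cover_within p f t S l <=
    h S l + 2 ^+ mass f S l * ((1 + p) / 2) ^+ t.
Proof.
move=> h0 h1 hs.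
have z0 : 0 <= (1 + p) / 2 by rewrite divr_ge0 // addr_ge0.
have z1 : (1 + p) / 2 <= 1.
  by rewrite ler_pdivrMr // mul1r -[leRHS]/(1 + 1) lerD2l.
have e0 S l t : 0 <= 2 ^+ mass f S l * ((1 + p) / 2) ^+ t.
  by rewrite mulr_ge0 // exprn_ge0.
elim=> [|t IH] S l lS.
  rewrite expr0 mulr1 ler_wpDl //= (@le_trans _ _ 1) ?gerBl ?ler0n //.
  by rewrite exprn_ege1 // ler1n.
have [SF|SF] := eqVneq S [set: 'I_n.+1]%SET.
  by rewrite cover_withinS // SF eqxx subrr addr_ge0.
case: l lS => [|v l] lS.
  rewrite (@le_trans _ _ 1) ?gerBl ?cover_within_ge0 //.
  by rewrite ler_wpDr // h1.
set l' := v :: l.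
rewrite cover_withinS // (negbTE SF).
have -> : forall F, 1 - step_mean p l' F = step_mean p l' (fun o => 1 - F o).
  move=> F; rewrite step_meanD step_mean1 //; congr (_ + _).
  by rewrite step_meanN.
apply: (@le_trans _ _ (step_mean p l' (fun o =>
   h (next_visited S o) (next_active f S o) + ((1 + p) / 2) ^+ t *
   2 ^+ mass f (next_visited S o) (next_active f S o)))).
  apply: le_step_mean => // o; rewrite [leRHS]addrC mulrC addrC; apply: IH.
  exact: next_active_sub lS.
rewrite step_meanD lerD ?hs // step_meanZ step_mean_surv.
(* Since [l'] is nonempty, one factor [(1 + p) / 2] is kept and the others are bounded by 1. *)
have key : (1 - p + p * 2) ^+ size l' <= 2 ^+ size l' * ((1 + p) / 2).
  have -> : 1 - p + p * 2 = 2 * ((1 + p) / 2) by field.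
  by rewrite exprMn ler_wpM2l ?exprn_ge0 // exprS ler_piMr // exprn_ile1.
rewrite /mass exprD exprS.
set b := (\sum_(_ | _) _)%N.
have -> : 2 ^+ size l' * 2 ^+ b * ((1 + p) / 2 * ((1 + p) / 2) ^+ t) =
  ((1 + p) / 2) ^+ t * 2 ^+ b * (2 ^+ size l' * ((1 + p) / 2)) :> R by ring.
by rewrite mulrA ler_wpM2l // mulr_ge0 ?exprn_ge0.
Qed.

End Comparison.

(* [hit_rate] is the [x] for which a particle never visits a given set of [k]
   vertices not containing its position with probability [1 / (1 + k * x)]. *)
Definition hit_rate (R : realType) (n : nat) (p : R) : R := p / (n%:R * (1 - p)).

Definition escape (R : realType) (n : nat) (p : R) (f : 'I_n.+1 -> nat)
    (U S : {set 'I_n.+1}) (l : seq 'I_n.+1) : R :=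
  [disjoint U & S]%:R * (1 + #|U|%:R * hit_rate n p)^-1 ^+ mass f S l.

(** * Harmonicity of the escape potential *)

Section Escape.
Variables (R : realType) (n : nat) (p : R) (f : 'I_n.+1 -> nat).
Hypotheses (n0 : (0 < n)%N) (p0 : 0 <= p) (p1 : p < 1).
Implicit Types (U S : {set 'I_n.+1}) (l : seq 'I_n.+1).

Local Notation x := (hit_rate n p).

Lemma hit_rate_ge0 : 0 <= x.
Proof. by rewrite divr_ge0 // mulr_ge0 // subr_ge0 ltW. Qed.

Lemma escape_base_gt0 (k : R) : 0 <= k -> 0 < 1 + k * x.
Proof. by move=> k0; rewrite ltr_pwDl // mulr_ge0 // hit_rate_ge0. Qed.

Lemma escape_ge0 U S l : 0 <= escape p f U S l.
Proof. by rewrite mulr_ge0 // exprn_ge0 // invr_ge0 ltW // escape_base_gt0. Qed.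

(** Particles stand outside [U], so with [k = #|U|] each contributes [1 - p + p (1 - k / n) c]:
    weight 1 if it dies, [c] if it survives outside [U], and 0 if it enters [U]. The value
    [c = 1 / (1 + k x)] is the fixed point of this map. *)
Lemma step_mean_escape U S l : {subset l <= S} ->
  step_mean p l (fun o => escape p f U (next_visited S o) (next_active f S o)) =
  escape p f U S l.
Proof.
move=> lS; rewrite /escape; set c := _^-1.
under eq_step_mean => o do rewrite disjoint_next mass_next.
case: (boolP [disjoint U & S]) => [US|_]; last first.
  by rewrite mul0r -[RHS](step_mean0 p l); apply: eq_step_mean => o; rewrite mul0r.
rewrite mul1r /mass addnC exprD.
pose g (y : option 'I_n.+1) : R := if y is Some w then if w \notin U then c else 0 else 1.
set b := (\sum_(_ | _) _)%N.
transitivity (step_mean p l (fun o => c ^+ b * \prod_(y <- o) g y)).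
  apply: eq_step_mean => o; rewrite addnC exprD mulrCA.  congr (_ * _).
  elim: o => [|[w|] o IH]; rewrite ?big_nil ?big_cons ?mulr1 //= -IH ?mul1r //.
  by case: (w \in U); rewrite /= ?mul0r // exprS mulrCA.
rewrite step_meanZ step_mean_prod; congr (_ * _).
rewrite (eq_big_seq (fun=> c)) => [|v vl].
  by rewrite big_const_seq count_predT -[LHS]/(iter _ _ _) iter_mulr mulr1.
have vU : v \notin U by rewrite (disjointFl US) // lS.
rewrite sum_move_prob // mulr1 /g.
have -> : \sum_(w | w != v) (if w \notin U then c else 0) = (n%:R - #|U|%:R) * c.
  rewrite -big_mkcondr /= sumr_const -[LHS]mulr_natl; congr (_ * _).
  set k := #|_|.
  have cU : (#|U| + k)%N = n.
    apply/eq_add_S; rewrite -[RHS]card_ord -(cardsC (v |: U)) cardsU1 vU add1n addSn.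
    by congr (_ + _).+1; apply: eq_card => w; rewrite !inE negb_or.
  have -> : n%:R = #|U|%:R + k%:R :> R by rewrite -natrD cU.
  by rewrite addrAC subrr add0r.
have cn0 : 1 + #|U|%:R * x != 0 by rewrite gt_eqF // escape_base_gt0.
have n0' : n%:R != 0 :> R by rewrite pnatr_eq0 -lt0n.
have p1' : 1 - p != 0 by rewrite gt_eqF // subr_gt0.
rewrite /c /hit_rate; move: cn0; rewrite /hit_rate => cn0.
field; rewrite n0' p1' /= gt_eqF // ltr_pwDl ?mulr_ge0 // mulr_gt0 ?subr_gt0 //.
by rewrite ltr0n.
Qed.

End Escape.

Lemma mass_start n (f : 'I_n.+1 -> nat) :
  mass f [set ord0] (nseq (1 + f ord0) ord0) = (1 + \sum_v f v)%N.
Proof.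
rewrite /mass size_nseq -addnA [in RHS](bigD1 ord0) //=; congr (_ + (_ + _))%N.
by apply: eq_bigl => v; rewrite inE.
Qed.

Lemma start_sub n (f : 'I_n.+1 -> nat) :
  {subset nseq (1 + f ord0) ord0 <= [set ord0 : 'I_n.+1]%SET}.
Proof. by move=> v; rewrite mem_nseq inE => /andP[]. Qed.

(** * Upper bound on coverage by the second moment method *)

Section CoverUpper.
Variables (R : realType) (n : nat) (p : R) (f : {ffun 'I_n.+1 -> nat}).
Hypotheses (n0 : (0 < n)%N) (p0 : 0 <= p) (p1 : p < 1).

Local Notation x := (hit_rate n p).
Local Notation esc := (escape p f).

Lemma cover_prob_ub (e : R) :
  (forall t, cover_within p f t [set ord0]%SET (nseq (1 + f ord0) ord0) <= e) ->
  cover_prob p f <= e.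
Proof.
move=> He; apply: ge_sup.
  by exists (cover_within p f 0 [set ord0]%SET (nseq (1 + f ord0) ord0)), 0%N.
by move=> _ [t _ <-].
Qed.

Lemma cover_within_le_prob t :
  cover_within p f t [set ord0]%SET (nseq (1 + f ord0) ord0) <= cover_prob p f.
Proof.
apply: ub_le_sup; last by exists t.
by exists 1 => _ [s _ <-]; exact: cover_within_le1.
Qed.

Lemma cover_prob_ge0 : 0 <= cover_prob p f.
Proof. by apply: le_trans (cover_within_le_prob 0); exact: cover_within_ge0. Qed.

Lemma cover_prob_le1 : cover_prob p f <= 1.
Proof. by apply: cover_prob_ub => t; exact: cover_within_le1. Qed.

Lemma escape_full (U : {set 'I_n.+1}) l : U != finset.set0 -> esc U [set: 'I_n.+1]%SET l = 0.
Proof.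
move=> U0; rewrite /escape -finset.setI_eq0 finset.setIT (negbTE U0).
by rewrite mul0r.
Qed.

(** For [v != w] this is [(1 + x)^2 >= 1 + 2 x]; for [v = w] it holds because the base is at most 1.
    Summed over pairs, it gives [X^2 <= Z]. *)
Lemma escape_pair_ge (S : {set 'I_n.+1}) l v w :
  esc [set v]%SET S l * esc [set w]%SET S l <= esc [set v; w]%SET S l.
Proof.
rewrite /escape !cards1 mul1r mulrACA -natrM mulnb.
have -> : [disjoint [set v; w] & S] = [disjoint [set v] & S] && [disjoint [set w] & S].
  by rewrite -!finset.setI_eq0 finset.setIUl finset.setU_eq0.
apply: ler_wpM2l => //; rewrite -exprMn; apply: lerXn2r.
- by rewrite nnegrE mulr_ge0 // invr_ge0 addr_ge0 // hit_rate_ge0.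
- by rewrite nnegrE invr_ge0 ltW // escape_base_gt0.
rewrite -invfM lef_pV2 ?posrE ?mulr_gt0 ?escape_base_gt0 //;
  try by rewrite ltr_pwDl // hit_rate_ge0.
have x0 : 0 <= x by apply: hit_rate_ge0.
rewrite finset.cards2; case: (v != w) => /=; nra.
Qed.

(* Second moment bound: the potential [1 - 2 a X + a^2 Z >= (1 - a X)^2] is 1 at
   full coverage; [X] and [Z] stand for the first two moments of the number of
   vertices left unvisited. *)
Lemma cover_prob_le (M := (1 + \sum_v f v)%N) :
  cover_prob p f <= (1 + x ^+ 2) ^+ M - 1 + (1 + x) ^+ M / n%:R.
Proof.
have x0 : 0 <= x by apply: hit_rate_ge0.
have n0' : 0 < n%:R :> R by rewrite ltr0n.
pose c1 := (1 + x)^-1; pose c2 := (1 + 2 * x)^-1.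
have c10 : 0 < c1 by rewrite invr_gt0 ltr_pwDl.
have c20 : 0 < c2 by rewrite invr_gt0 ltr_pwDl // mulr_ge0.
(* The inverse of the initial value of [X], so that the linear term [2 * a * X] starts at 2. *)
pose a := (n%:R * c1 ^+ M)^-1.
pose X S l := \sum_v esc [set v]%SET S l.
pose Z S l := \sum_v \sum_w esc [set v; w]%SET S l.
pose h S l := 1 - 2 * a * X S l + a ^+ 2 * Z S l.
have a0 : 0 < a by rewrite invr_gt0 mulr_gt0 // exprn_gt0.
have XZ S l : X S l ^+ 2 <= Z S l.
  rewrite expr2 big_distrlr /=; apply: ler_sum => v _; apply: ler_sum => w _.
  exact: escape_pair_ge.
have h0 S l : 0 <= h S l.
  apply: (@le_trans _ _ ((1 - a * X S l) ^+ 2)); first exact: sqr_ge0.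
  have := ler_wpM2l (sqr_ge0 a) (XZ S l); rewrite /h; nra.
have h1 l : 1 <= h [set: 'I_n.+1]%SET l.
  rewrite /h /X /Z !big1 ?mulr0 ?addr0 ?subr0 // => [v _|v _].
    rewrite big1 // => w _; rewrite escape_full //.
    by apply/set0Pn; exists v; rewrite !inE eqxx.
  by rewrite escape_full //; apply/set0Pn; exists v; rewrite inE.
have hs : superharmonic p f h.
  move=> S l lS; rewrite /h !step_meanD step_mean1 // step_meanZ.
  rewrite lerD // ?lerD //.
    rewrite step_meanN lerN2 step_meanZ ler_wpM2l ?mulr_ge0 ?(ltW a0) // step_mean_sum /X.
    by apply: ler_sum => v _; rewrite step_mean_escape.
  rewrite ler_wpM2l ?sqr_ge0 // step_mean_sum /Z; apply: ler_sum => v _.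
  by rewrite step_mean_sum; apply: ler_sum => w _; rewrite step_mean_escape.
apply: cover_prob_ub => t.
apply: le_trans (cover_within_le p0 p1 h0 h1 hs t (start_sub (f := f))) _.
have cX : X [set ord0]%SET (nseq (1 + f ord0) ord0) = n%:R * c1 ^+ M.
  rewrite /X (bigD1 ord0) //= {1}/escape mass_start.
  rewrite -finset.setI_eq0 finset.setIid -cards_eq0 cards1 mul0r add0r.
  rewrite (eq_bigr (fun=> c1 ^+ M)); last first.
    move=> v v0; rewrite /escape mass_start cards1 mul1r disjoints1 inE v0 mul1r //.
  by rewrite sumr_const cardC1 card_ord mulr_natl.
(* Diagonal pairs give [c1 ^+ M] and the others [c2 ^+ M]; adding [c2 ^+ M] on the diagonal as well
   makes the double sum factor. *)
have cZ : Z [set ord0]%SET (nseq (1 + f ord0) ord0) <=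
    n%:R * c1 ^+ M + n%:R ^+ 2 * c2 ^+ M.
  rewrite /Z.
  apply: (@le_trans _ _ (\sum_v \sum_w (v != ord0)%:R * (w != ord0)%:R *
     ((v == w)%:R * c1 ^+ M + c2 ^+ M))).
    apply: ler_sum => v _; apply: ler_sum => w _; rewrite /escape mass_start.
    have -> : [disjoint [set v; w] & [set ord0 : 'I_n.+1]%SET] = (v != ord0) && (w != ord0).
      by rewrite disjoint_sym disjoints1 !inE negb_or ![ord0 == _]eq_sym.
    rewrite -mulnb natrM ler_wpM2l ?mulr_ge0 // finset.cards2 /c1 /c2.
    case: (v == w) => /=; rewrite ?mul1r ?mul0r ?add0r //.
    by rewrite lerDl exprn_ge0 // ltW.
  under eq_bigr => v _.
    under eq_bigr do rewrite mulrDr -mulrA.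
    rewrite big_split /= -big_distrr /= (bigD1 v) //= big1 => [|w vw]; last first.
      by rewrite [v == w]eq_sym (negbTE vw) mul0r mulr0.
    rewrite eqxx addr0 mul1r mulrA -natrM mulnb andbb.
    rewrite -big_distrl -big_distrr /=.
    over.
  have cn : \sum_(v : 'I_n.+1) (v != ord0)%:R = n%:R :> R.
    rewrite (bigD1 ord0) //= add0r (eq_bigr (fun=> 1)) => [|v ->] //.
    by rewrite sumr_const cardC1 card_ord.
  by rewrite big_split /= -!mulr_suml cn expr2.
rewrite /h cX.
have -> : 2 * a * (n%:R * c1 ^+ M) = 2.
  by rewrite -mulrA mulVf ?mulr1 // gt_eqF // mulr_gt0 // exprn_gt0.
have Zb := ler_wpM2l (sqr_ge0 a) cZ.
have aE : a ^+ 2 * (n%:R * c1 ^+ M + n%:R ^+ 2 * c2 ^+ M) =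
    (1 + x) ^+ M / n%:R + (c2 * (1 + x) ^+ 2) ^+ M.
  have xM : (1 + x) ^+ M != 0 by rewrite expf_neq0 // gt_eqF // ltr_pwDl.
  have c1M : c1 ^+ M = ((1 + x) ^+ M)^-1 by rewrite exprVn.
  rewrite /a c1M exprMn [((1 + x) ^+ 2) ^+ M]exprAC.
  move: ((1 + x) ^+ M) (c2 ^+ M) xM => u w u0.
  by field; rewrite u0 gt_eqF.
(* [(1 + x^2) (1 + 2 x)] exceeds [(1 + x)^2] by [2 x^3]. *)
have cb : (c2 * (1 + x) ^+ 2) ^+ M <= (1 + x ^+ 2) ^+ M.
  apply: lerXn2r.
  - by rewrite nnegrE mulr_ge0 ?sqr_ge0 // ltW.
  - by rewrite nnegrE addr_ge0 ?sqr_ge0.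
  - rewrite /c2 mulrC ler_pdivrMr ?escape_base_gt0 //.
    have := mulr_ge0 x0 (sqr_ge0 x); nra.
rewrite aE in Zb. apply: le_trans (lerD (lexx _) Zb) _.
move: cb; move: (_ ^+ M) (_ ^+ M) (_ / _) => A B C AB; lra.
Qed.

End CoverUpper.

(** * Lower bound on coverage by a union over the unvisited sets *)

Section CoverLower.
Variables (R : realType) (n : nat) (p : R) (f : {ffun 'I_n.+1 -> nat}).
Hypotheses (n0 : (0 < n)%N) (p0 : 0 <= p) (p1 : p < 1).
Implicit Types (S T U : {set 'I_n.+1}) (l : seq 'I_n.+1).

Local Notation x := (hit_rate n p).
Local Notation esc := (escape p f).

(** Counting such vertices instead of their particles makes each jump raise the count by at most
    1. *)
Definition fertile S : {set 'I_n.+1} := [set v in S | (0 < f v)%N].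

(** Each newly visited fertile vertex wakes at least one particle, so progress in fertile vertices
    bounds the number of woken particles from below. *)
Lemma card_fertile_next S o :
  (#|fertile (next_visited S o)| <=
   #|fertile S| + \sum_(v | (v \in pmap id o) && (v \notin S)) f v)%N.
Proof.
apply: (@leq_trans (#|fertile S| +
    #|[set v | (v \in pmap id o) && (v \notin S) & (0 < f v)%N]|)%N).
  apply: leq_trans (leq_card_setU _ _); apply/subset_leq_card/fintype.subsetP => v.
  rewrite !inE => /andP[/orP[vS|vo] fv]; first by rewrite vS fv.
  by rewrite vo fv !andbT orbN.
rewrite leq_add2l cardE -sum1_size big_enum_cond /=.
rewrite [leqRHS](bigID (fun v => 0 < f v)%N) /=.
apply: leq_trans (leq_addr _ _).
rewrite [leqLHS](eq_bigl (fun v => (v \in pmap id o) && (v \notin S) && (0 < f v)%N)).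
  by apply: leq_sum => v /andP[_].
by move=> v; rewrite ?inE ?andbT.
Qed.

Lemma card_fertile_le S o : (#|fertile S| <= #|fertile (next_visited S o)|)%N.
Proof.
by apply/subset_leq_card/fintype.subsetP => v; rewrite !inE => /andP[-> ->].
Qed.

Lemma card_fertile1 T w :
  #|fertile (next_visited T [:: Some w])| = (#|fertile T| + ((0 < f w)%N && (w \notin T)))%N.
Proof.
have -> : fertile (next_visited T [:: Some w]) =
    if (0 < f w)%N && (w \notin T) then w |: fertile T else fertile T.
  apply/setP => v; case: ifP => [/andP[fw wT]|wfT]; rewrite !inE /= ?inE.
    by case: eqP => [->|_]; rewrite ?orbF ?orbT ?fw.
  case: eqP wfT => [->|_]; rewrite ?orbF ?orbT //.
  by case: (0 < f w)%N => /=; rewrite ?andbF // => /negbFE ->.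
case: ifP => [/andP[fw wT]|_]; last by rewrite addn0.
by rewrite cardsU1 inE (negbTE wT) addnC.
Qed.

(* While fewer than [thr] fertile vertices are visited, each jump wakes a
   fertile vertex with probability at least [k], independently of the earlier
   jumps of the same step. *)
Lemma drift_fertile (th k thr : R) :
  0 <= th -> th <= 1 -> thr + k * n%:R <= #|fertile [set: 'I_n.+1]%SET|%:R ->
  1 - p + p * th * (1 - k * (1 - th)) <= th ->
  forall l T, {subset l <= T} ->
  step_mean p l (fun o => (#|fertile (next_visited T o)|%:R < thr)%R%:R *
     th ^+ (size (pmap id o) + #|fertile (next_visited T o)|)%N)
  <= th ^+ (size l + #|fertile T|)%N.
Proof.
move=> th0 th1 Hthr Hth; elim=> [|v l IH] T lT.
  by rewrite /= next_visited_nil ler_piMl ?exprn_ge0 // lern1 leq_b1.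
(* Past the threshold the indicator stays 0, because the fertile visited set only grows. *)
have [dT|dT] := ltP (#|fertile T|%:R) thr; last first.
  apply: (@le_trans _ _ (step_mean p (v :: l) (fun=> 0))); last first.
    by rewrite step_mean0 exprn_ge0.
  apply: le_step_mean => [//||o]; first exact: ltW.
  by rewrite ltNge (le_trans dT) ?mul0r // ler_nat card_fertile_le.
pose g (y : option 'I_n.+1) : R :=
  th ^+ (y + size l + #|fertile (next_visited T [:: y])|)%N.
apply: (@le_trans _ _ (\sum_y move_prob p v y * g y)).
  rewrite step_mean_cons; apply: ler_sum => y _.
  rewrite ler_wpM2l // ?(move_prob_ge0 p0 (ltW p1)) //.
  under eq_step_mean => o.
    rewrite next_visited_cons.
    have -> : size (pmap id (y :: o)) = (y + size (pmap id o))%N by case: y.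
    rewrite -addnA exprD mulrCA.
    over.
  rewrite step_meanZ /g -addnA exprD ler_wpM2l ?exprn_ge0 //.
  apply: IH => w wl; rewrite !inE lT ?inE ?wl ?orbT //.
pose c w := ((0 < f w)%N && (w \notin T)).
set e := th ^+ (size l + #|fertile T|)%N.
have e0 : 0 <= e by rewrite exprn_ge0.
rewrite sum_move_prob //.
have -> : g None = e.
  by rewrite /g -[next_visited T [:: None]]/(next_visited T [::]) next_visited_nil.
have gS w : g (Some w) = th * e * (1 - (1 - th) * (c w)%:R).
  rewrite /g card_fertile1 -/(c w) -addnA [(size l + _)%N]addnA addSn add0n exprS exprD -/e.
  by case: (c w) => /=; ring.
under eq_bigr => w _ do rewrite gS.
set m : R := #|fertile [set: 'I_n.+1]%SET|%:R - #|fertile T|%:R.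
(* Excluding the current position [v] loses nothing: [v] lies in [T], so it is not a new vertex. *)
have sc : \sum_(w | w != v) (c w)%:R = m.
  have -> : m = (\sum_(w | w != v) c w)%N%:R.
    rewrite /m; apply/eqP; rewrite subr_eq -natrD eqr_nat addnC; apply/eqP.
    rewrite -(cardsID T); congr (_ + _)%N.
      by apply: eq_card => w; rewrite !inE andbC.
    rewrite -sum1_card big_mkcond [RHS]big_mkcond; apply: eq_bigr => w _.
    rewrite !inE /c; case: (eqVneq w v) => [->|_] /=; first by rewrite lT ?inE ?eqxx.
    by rewrite andbC; case: (_ && _).
  by rewrite natr_sum.
rewrite -mulr_sumr sumrB sumr_const cardC1 card_ord -mulr_sumr sc.
have n0' : 0 < n%:R :> R by rewrite ltr0n.
have mk : k * n%:R <= m by rewrite /m; lra.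
have mk' : k <= m / n%:R by rewrite ler_pdivlMr.
rewrite addSn exprS -/e.
have -> : (1 - p) * e + p / n%:R * (th * e * (n%:R - (1 - th) * m)) =
   (1 - p + p * th * (1 - m / n%:R * (1 - th))) * e by field; rewrite gt_eqF.
rewrite ler_wpM2r //; apply: le_trans Hth.
rewrite lerD2l ler_wpM2l ?mulr_ge0 // lerD2l lerN2 ler_wpM2r //; lra.
Qed.

(** A process that dies short of full coverage either visited fewer than [thr] fertile vertices, and
    then the term in [th] equals 1, or leaves exactly some admissible [U] unvisited. The remaining
    mass is then the number of particles in [U], and the weight in front of [esc U] cancels it to
    give 1. *)
Lemma cover_prob_ge (th k thr : R) :
  0 < th -> th <= 1 -> thr + k * n%:R <= #|fertile [set: 'I_n.+1]%SET|%:R ->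
  1 - p + p * th * (1 - k * (1 - th)) <= th ->
  1 - cover_prob p f <=
  th + \sum_(U | (U != finset.set0) && (thr <= #|fertile (~: U)%SET|%:R))
         (1 + #|U|%:R * x)^-1 ^+ (\sum_(v | v \notin U) f v)%N.
Proof.
move=> th_gt0 th1 Hthr Hth; have th0 := ltW th_gt0.
pose P U := (U != finset.set0) && (thr <= #|fertile (~: U)%SET|%:R).
pose c U := 1 + #|U|%:R * x.
have c0 U : 0 < c U by rewrite escape_base_gt0.
pose h S l : R := \sum_(U | P U) c U ^+ (\sum_(v in U) f v)%N * esc U S l +
  (#|fertile S|%:R < thr)%R%:R * th ^+ size l.
have h0 S l : 0 <= h S l.
  rewrite addr_ge0 ?mulr_ge0 ?exprn_ge0 // sumr_ge0 // => U _.
  by rewrite mulr_ge0 ?escape_ge0 // exprn_ge0 // ltW.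
have h1 S : S != [set: 'I_n.+1]%SET -> 1 <= h S [::].
  move=> ST; rewrite /h expr0 mulr1.
  have [dS|dS] := ltP.
    by rewrite ler_wpDl // sumr_ge0 // => U _; rewrite mulr_ge0 ?escape_ge0 // exprn_ge0 // ltW.
  have PS : P (~: S)%SET.
    rewrite /P finset.setCK dS andbT; apply: contra ST => /eqP S0.
    by rewrite -[S]finset.setCK S0 finset.setC0.
  rewrite addr0 (bigD1 (~: S)%SET) //= ler_wpDr //.
    by rewrite sumr_ge0 // => U _; rewrite mulr_ge0 ?escape_ge0 // exprn_ge0 // ltW.
  rewrite /escape -finset.setI_eq0 finset.setIC finset.setICr eqxx mul1r /mass add0n.
  rewrite (eq_bigl (fun v => v \in (~: S)%SET)) => [|v]; last by rewrite inE.
  by rewrite exprVn divff // expf_neq0 // gt_eqF.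
have hs : superharmonic p f h.
  move=> S l lS; rewrite /h step_meanD lerD //.
    rewrite step_mean_sum; apply: ler_sum => U _.
    by rewrite step_meanZ step_mean_escape.
  have [dS|dS] := ltP (#|fertile S|%:R) thr; last first.
    rewrite mul0r -[leRHS](step_mean0 p l); apply: le_step_mean => // [|o]; first exact: ltW.
    by rewrite ltNge (le_trans dS) ?mul0r // ler_nat card_fertile_le.
  have := drift_fertile th0 th1 Hthr Hth lS.
  rewrite mul1r exprD => H.
  (* Multiplying by [th ^+ #|fertile S|] reduces to [drift_fertile], since by [card_fertile_next] at
     least as many particles wake as fertile vertices are gained. *)
  rewrite -(ler_pM2r (x := th ^+ #|fertile S|)) ?exprn_gt0 //.
  apply: le_trans H; rewrite mulrC -step_meanZ; apply: le_step_mean => // [|o]; first exact: ltW.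
  rewrite mulrCA ler_wpM2l // -exprD.
  by apply: ler_wiXn2l => //; rewrite size_next_active; have := card_fertile_next S o; lia.
have z1 : `|(1 + p) / 2| < 1.
  by rewrite ger0_norm ?divr_ge0 ?addr_ge0 // ltr_pdivrMr // mul1r -[ltRHS]/(1 + 1) ltrD2l.
pose s := nseq (1 + f ord0) (ord0 : 'I_n.+1).
have hst : h [set ord0]%SET s <= th + \sum_(U | P U) (c U)^-1 ^+ (\sum_(v | v \notin U) f v)%N.
  rewrite /h [leLHS]addrC lerD //.
    apply: (@le_trans _ _ (th ^+ size s)).
      by rewrite ler_piMl ?exprn_ge0 // lern1 leq_b1.
    by rewrite size_nseq add1n exprS ler_piMr // exprn_ile1.
  apply: ler_sum => U _; rewrite /escape mass_start mulrCA.
  have ci0 k' : 0 <= (1 + #|U|%:R * x)^-1 ^+ k' by rewrite exprn_ge0 // invr_ge0 (ltW (c0 U)).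
  apply: (@le_trans _ _ (c U ^+ (\sum_(v in U) f v)%N *
      (1 + #|U|%:R * x)^-1 ^+ (1 + \sum_v f v)%N)).
    by rewrite ler_piMl ?lern1 ?leq_b1 // mulr_ge0 // exprn_ge0 // (ltW (c0 U)).
  have -> : (\sum_v f v = \sum_(v in U) f v + \sum_(v | v \notin U) f v)%N.
    by rewrite (bigID (mem U)).
  rewrite !exprD expr1 mulrCA [X in _ * X]mulrA -exprMn.
  rewrite divff ?gt_eqF // expr1n mul1r ler_piMl //.
  by rewrite invf_le1 ?escape_base_gt0 // lerDl mulr_ge0 // hit_rate_ge0.
apply: le_trans hst.
set B : R := 2 ^+ mass f [set ord0]%SET s.
(* The term for particles still active vanishes as the time horizon tends to infinity. *)
have cv : ((fun t => h [set ord0]%SET s + B * ((1 + p) / 2) ^+ t) @ \oo -->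
    h [set ord0]%SET s + B * 0)%classic.
  by apply: cvgD; [exact: cvg_cst|apply: cvgM; [exact: cvg_cst|exact: cvg_expr]].
rewrite mulr0 addr0 in cv; rewrite -(cvg_lim _ cv) //.
apply: limr_ge; first exact: cvgP cv.
near=> t.
apply: le_trans (cover_within_ge n0 p0 p1 h0 h1 hs t (start_sub (f := f))).
by rewrite lerD2l lerN2 cover_within_le_prob.
Unshelve. all: by end_near.
Qed.

End CoverLower.

(** * Sums against the product law of the configuration *)

Section ProductLaw.
Variables (R : realType).
Local Open Scope ereal_scope.

(** Induction on the number of coordinates; the constant [c] absorbs the weight of the coordinate
    split off. *)
Lemma esum_prod (a : nat -> R) (A c : R) (N : nat) :
  (forall k, (0 <= a k)%R) -> \sum_(0 <= k <oo) (a k)%:E = A%:E -> (0 <= c)%R ->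
  \esum_(f in [set: {ffun 'I_N -> nat}]%classic) (c * \prod_v a (f v))%R%:E =
  (c * A ^+ N)%R%:E.
Proof.
move=> a0 aA; elim: N c => [|N IH] c c0.
  have -> : [set: {ffun 'I_0 -> nat}]%classic = [set [ffun=> 0%N]]%classic.
    by apply/classical_sets.seteqP; split=> // f _; apply/ffunP => -[].
  by rewrite esum_set1 ?big_ord0 ?expr0 // mulr1 lee_fin.
pose e (kg : nat * {ffun 'I_N -> nat}) : {ffun 'I_N.+1 -> nat} :=
  [ffun i => if unlift ord0 i is Some j then kg.2 j else kg.1].
have be : set_bij [set: nat * {ffun 'I_N -> nat}]%classic [set: {ffun 'I_N.+1 -> nat}]%classic e.
  split=> // [[k g] [k' g'] _ _ /ffunP H|f _].
    congr pair; first by have := H ord0; rewrite !ffunE unlift_none.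
    by apply/ffunP => j; have := H (lift ord0 j); rewrite !ffunE liftK.
  exists (f ord0, [ffun j => f (lift ord0 j)]) => //.
  by apply/ffunP => i; rewrite !ffunE; case: unliftP => [j ->|->] //=; rewrite ffunE.
rewrite (@reindex_esum _ _ _ _ _ e _ be).
have -> : [set: nat * {ffun 'I_N -> nat}]%classic =
    ([set: nat] `*`` (fun=> [set: {ffun 'I_N -> nat}]))%classic.
  by apply/classical_sets.seteqP; split.
transitivity (\esum_(k in [set: nat]%classic) \esum_(g in [set: {ffun 'I_N -> nat}]%classic)
    (c * a k * \prod_v a (g v))%R%:E).
  rewrite esum_esum => [|k g _ _]; last by rewrite lee_fin !mulr_ge0 ?prodr_ge0.
  apply: eq_esum => -[k g] _ /=; congr _%:E.
  rewrite big_ord_recl !ffunE unlift_none /= -mulrA; congr (_ * (_ * _))%R.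
  by apply: eq_bigr => i _; rewrite ffunE liftK.
under eq_esum => k _ do rewrite IH ?mulr_ge0 //.
rewrite -nneseries_esumT => [|k].
  rewrite (eq_eseriesr (g := fun k => (c * A ^+ N)%R%:E * (a k)%:E)) => [|k _]; last first.
    by rewrite -EFinM mulrAC.
  rewrite nneseriesZl => [|i _]; last by rewrite lee_fin.
  by rewrite [X in _ * X]aA -EFinM exprSr mulrA.
rewrite lee_fin !mulr_ge0 ?exprn_ge0 //.
by rewrite -lee_fin -aA nneseries_ge0 // => i _ _; rewrite lee_fin.
Qed.

Variable q : option nat -> R.
Hypotheses (q0 : forall y, (0 <= q y)%R) (q1 : \sum_(0 <= k <oo) (q (Some k))%:E = 1).

(** [fine] sends an infinite sum to 0; [law_meanE] excludes this case for nonnegative bounded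
    [g]. *)
Definition law_mean (g : nat -> R) : R :=
  fine (\sum_(0 <= k <oo) (q (Some k) * g k)%R%:E).

Lemma law_meanE g (B : R) : (forall k, (0 <= g k <= B)%R) ->
  \sum_(0 <= k <oo) (q (Some k) * g k)%R%:E = (law_mean g)%:E.
Proof.
move=> gB; rewrite fineK // ge0_fin_numE; last first.
  by apply: nneseries_ge0 => k _ _; rewrite lee_fin mulr_ge0 //; case/andP: (gB k).
apply: (@le_lt_trans _ _ (\sum_(0 <= k <oo) B%:E * (q (Some k))%:E)); last first.
  by rewrite nneseriesZl ?q1 ?mule1 ?ltry // => k _; rewrite lee_fin.
apply: lee_nneseries => [k _ _|k _]; rewrite ?lee_fin ?mulr_ge0 //; case/andP: (gB k) => // g0 gb.
by rewrite mulrC ler_wpM2r.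
Qed.

Lemma law_mean_ge0 g : (forall k, (0 <= g k)%R) -> (0 <= law_mean g)%R.
Proof.
by move=> g0; rewrite fine_ge0 // nneseries_ge0 // => k _ _; rewrite lee_fin mulr_ge0.
Qed.

(** Every term stays on the side where it is nonnegative, so that the series can be added as
    extended reals. *)
Lemma law_mean_le_affine (g h : nat -> R) (B c d : R) :
  (forall k, (0 <= g k <= B)%R) -> (forall k, (0 <= h k <= B)%R) -> (0 <= c)%R -> (0 <= d)%R ->
  (forall k, (g k + c * h k <= d)%R) -> (law_mean g + c * law_mean h <= d)%R.
Proof.
move=> gB hB c0 d0 H.
have g0 k : (0 <= g k)%R by case/andP: (gB k).
have h0 k : (0 <= h k)%R by case/andP: (hB k).
rewrite -lee_fin EFinD EFinM -(law_meanE gB) -(law_meanE hB).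
rewrite -nneseriesZl => [|k _]; last by rewrite lee_fin mulr_ge0.
rewrite -nneseriesD => [||]; try by move=> k _ _; rewrite ?lee_fin ?mule_ge0 ?lee_fin ?mulr_ge0.
rewrite -[leRHS]mule1 -q1 -nneseriesZl => [|k _]; last by rewrite lee_fin.
apply: lee_nneseries => [k _ _|k _].
  by rewrite adde_ge0 ?mule_ge0 ?lee_fin ?mulr_ge0.
by rewrite -!EFinM -EFinD lee_fin mulrCA -mulrDr mulrC ler_wpM2r.
Qed.

Lemma law_mean_ge_tangent (g : nat -> R) (mu s : R) : (0 <= s)%R ->
  (forall k, (0 <= g k <= 1)%R) -> (forall k, (1 - s * k%:R <= g k)%R) ->
  \sum_(0 <= k <oo) (k%:R * q (Some k))%R%:E = mu%:E -> (1 - s * mu <= law_mean g)%R.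
Proof.
move=> s0 g1 Hg Hmu; rewrite lerBlDr -lee_fin EFinD EFinM -(law_meanE g1) -Hmu -q1.
have g0 k : (0 <= g k)%R by case/andP: (g1 k).
rewrite -nneseriesZl => [|k _]; last by rewrite lee_fin mulr_ge0.
rewrite -nneseriesD => [||]; try by move=> k _ _; rewrite ?lee_fin ?mule_ge0 ?lee_fin ?mulr_ge0.
apply: lee_nneseries => [k _ _|k _]; first by rewrite lee_fin.
rewrite -!EFinM -EFinD lee_fin mulrA [X in (_ + X)%R]mulrC -mulrDr ler_peMr // -lerBlDr.
exact: Hg.
Qed.

(** Some partial sum of the mean already exceeds [b], and [minn k K] is [k] on its range. The mean
    may be infinite. *)
Lemma law_mean_min_gt (b : R) : b%:E < \sum_(0 <= k <oo) (k%:R * q (Some k))%R%:E ->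
  exists K : nat, (b < law_mean (fun k => (minn k K)%:R))%R.
Proof.
move=> bm.
have [K HK] : exists K, b%:E < \sum_(0 <= k < K) (k%:R * q (Some k))%R%:E.
  apply/not_existsP => H; move: bm; apply/negP; rewrite -leNgt.
  apply: lime_le; first by apply: is_cvg_nneseries => k _ _; rewrite lee_fin mulr_ge0.
  by apply: nearW => K; rewrite leNgt; apply/negP.
exists K; rewrite -lte_fin -(law_meanE (B := K%:R)) => [|k]; last first.
  by rewrite ler0n ler_nat geq_minr.
apply: lt_le_trans HK _.
apply: (@le_trans _ _ (\sum_(0 <= k < K) (q (Some k) * (minn k K)%:R)%R%:E)).
  rewrite !big_nat; apply: lee_sum => k /andP[_ kK].
  by rewrite lee_fin mulrC (minn_idPl (ltnW kK)).
by apply: nneseries_lim_ge => k _ _; rewrite lee_fin mulr_ge0.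
Qed.

End ProductLaw.

(** * From a fixed configuration to the random one *)

Section Annealed.
Variables (R : realType) (q : option nat -> R) (n : nat) (p : R).
Hypotheses (q0 : forall y, 0 <= q y) (qN : q None = 0).
Hypothesis (q1 : (\sum_(0 <= k <oo) (q (Some k))%:E = 1)%E).
Hypotheses (n0 : (0 < n)%N) (p0 : 0 <= p) (p1 : p < 1).

Local Notation config := {ffun 'I_n.+1 -> nat}.
Local Notation weight f := (\prod_(v < n.+1) q (Some (f v))).
Local Notation mean G :=
  (\esum_(f in [set: config]%classic) (weight f * G f)%:E)%E.

Let weight_ge0 (f : config) : 0 <= weight f.
Proof. by apply: prodr_ge0. Qed.

Let mean_const c : 0 <= c -> (mean (fun=> c) = c%:E)%E.
Proof.
move=> c0; have := esum_prod (a := fun k => q (Some k)) n.+1 (fun k => q0 _) q1 c0.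
rewrite expr1n mulr1 => <-; apply: eq_esum => f _.
by rewrite mulrC.
Qed.

Let mean_prod c (g : nat -> R) : 0 <= c -> (forall k, 0 <= g k <= 1) ->
  (mean (fun f => c * \prod_v g (f v)) = (c * law_mean q g ^+ n.+1)%:E)%E.
Proof.
move=> c0 g1.
have a0 k : 0 <= q (Some k) * g k by rewrite mulr_ge0 //; case/andP: (g1 k).
rewrite -(esum_prod n.+1 a0 (law_meanE q0 q1 g1) c0); apply: eq_esum => f _.
by rewrite mulrCA -big_split.
Qed.

Let mean_cover : (mean (cover_prob p) = (all_visited_prob_S q n p)%:E)%E.
Proof.
rewrite /all_visited_prob_S qN ltxx (lt_eqF p1) /= fineK // ge0_fin_numE.
  apply: (@le_lt_trans _ _ (mean (fun=> 1))%E); last by rewrite mean_const ?ltry.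
  by apply: le_esum => f _; rewrite lee_fin ler_wpM2l // cover_prob_le1.
by apply: esum_ge0 => f _; rewrite lee_fin mulr_ge0 // cover_prob_ge0.
Qed.

Let prod_ge0 (g : nat -> R) (f : config) : (forall k, 0 <= g k <= 1) ->
  0 <= \prod_v g (f v).
Proof. by move=> g1; apply: prodr_ge0 => v _; case/andP: (g1 (f v)). Qed.

(** Integrates a bound valid for each configuration; by independence, product test functions
    integrate to powers of [law_mean]. A term to be subtracted goes to the left, keeping all sums
    nonnegative. *)
Lemma all_visited_le (c1 c2 c3 : R) (g1 g2 : nat -> R) :
  0 <= c1 -> 0 <= c2 -> 0 <= c3 ->
  (forall k, 0 <= g1 k <= 1) -> (forall k, 0 <= g2 k <= 1) ->
  (forall f : config, cover_prob p f + c1 * \prod_v g1 (f v) <=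
                      c2 * \prod_v g2 (f v) + c3) ->
  all_visited_prob_S q n p + c1 * law_mean q g1 ^+ n.+1 <=
  c2 * law_mean q g2 ^+ n.+1 + c3.
Proof.
move=> c10 c20 c30 g1b g2b H.
rewrite -lee_fin !EFinD -mean_cover -!mean_prod // -(mean_const c30).
rewrite -!esumD; try by move=> f _; rewrite lee_fin !mulr_ge0 ?prod_ge0 ?cover_prob_ge0.
by apply: le_esum => f _; rewrite -!EFinD lee_fin -!mulrDr ler_wpM2l.
Qed.

Lemma all_visited_ge (c2 c3 : R) (g : nat -> R) :
  0 <= c2 -> 0 <= c3 -> (forall k, 0 <= g k <= 1) ->
  (forall f : config, 1 <= cover_prob p f + (c2 * \prod_v g (f v) + c3)) ->
  1 <= all_visited_prob_S q n p + (c2 * law_mean q g ^+ n.+1 + c3).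
Proof.
move=> c20 c30 gb H.
rewrite -lee_fin !EFinD -mean_cover -(mean_const ler01) -!mean_prod // -(mean_const c30).
rewrite -!esumD; try by move=> f _; rewrite ?adde_ge0 ?lee_fin ?mulr_ge0 ?prod_ge0 ?cover_prob_ge0.
by apply: le_esum => f _; rewrite -!EFinD lee_fin -!mulrDr ler_wpM2l.
Qed.

Lemma all_visited_le1 : all_visited_prob_S q n p <= 1.
Proof.
rewrite -lee_fin -mean_cover -(mean_const ler01); apply: le_esum => f _.
by rewrite lee_fin ler_wpM2l // cover_prob_le1.
Qed.

Lemma all_visited_ge0 : 0 <= all_visited_prob_S q n p.
Proof.
by rewrite -lee_fin -mean_cover; apply: esum_ge0 => f _;
   rewrite lee_fin mulr_ge0 // cover_prob_ge0.
Qed.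

End Annealed.

(** * Sums over subsets of vertices *)

Section SubsetSums.
Variables (R : realType) (T : finType).

Lemma sum_expr_card (z : R) : \sum_(U : {set T}) z ^+ #|U| = (1 + z) ^+ #|T|.
Proof.
have := @bigA_distr R 0 1 *%R +%R T (fun=> z) (fun=> 1).
rewrite /= prodr_const addrC => ->; apply: eq_bigr => U _.
by rewrite -big_mkcond prodr_const.
Qed.

Lemma exprV_le_expR (t r s : R) (m : nat) :
  expR r <= t -> s <= r * m%:R -> t^-1 ^+ m <= expR (- s).
Proof.
move=> rt sr; have t0 : 0 < t by apply: lt_le_trans rt; exact: expR_gt0.
apply: (@le_trans _ _ (expR (- r) ^+ m)).
  apply: lerXn2r; rewrite ?nnegrE ?invr_ge0 ?expR_ge0 ?(ltW t0) //.
  by rewrite expRN lef_pV2 // posrE expR_gt0.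
by rewrite -expRM_natl ler_expR mulrN lerN2 mulrC.
Qed.

(** [1 / (1 + t) = 1 - t / (1 + t) <= 1 - t / (1 + eta)], then the tangent bound of [expR]. *)
Lemma expR_div_le (t eta : R) : 0 <= t -> t <= eta -> expR (t / (1 + eta)) <= 1 + t.
Proof.
move=> t0 te; have t1 : 0 < 1 + t by rewrite ltr_pwDl.
rewrite -lef_pV2 ?posrE ?expR_gt0 // -expRN.
apply: le_trans (expR_ge1Dx _).
have -> : (1 + t)^-1 = 1 - t / (1 + t) by field; rewrite gt_eqF.
rewrite lerD2l lerN2 ler_wpM2l // lef_pV2 ?posrE //; lra.
Qed.

Lemma expr1D_le_expR (y : R) m : 0 <= 1 + y -> (1 + y) ^+ m <= expR (m%:R * y).
Proof.
move=> y0; rewrite expRM_natl; apply: lerXn2r; rewrite ?nnegrE ?expR_ge0 //.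
exact: expR_ge1Dx.
Qed.

(* Sets [U] are sorted by size: for [#|U| * x <= eta] the term is at most
   [expR (- beta * #|U|)]; for the other sets with [#|U| <= eps * #|T|] it is
   exponentially small, and there are few of them (Chernoff with tilt [zeta]);
   beyond that it beats the [2 ^ #|T|] available sets. *)
Lemma sum_escape_le (P : pred {set T}) (F : {set T} -> nat)
    (x eta gam eps beta zeta : R) (N : R := #|T|%:R) :
  0 < x -> 0 < eta -> 0 < gam -> 0 <= zeta ->
  (forall U, P U -> U != finset.set0) ->
  (forall U, P U -> gam * N <= (F U)%:R) ->
  (forall U, P U -> #|U|%:R * x <= eta -> beta * (1 + eta) <= x * (F U)%:R) ->
  (forall U : {set T}, eps * N < #|U|%:R -> expR (2 / gam) <= 1 + #|U|%:R * x) ->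
  \sum_(U | P U) (1 + #|U|%:R * x)^-1 ^+ F U <=
  (expR (N * expR (- beta)) - 1) +
  expR (- (N * (gam * ln (1 + eta) - zeta * eps - expR (- zeta)))) + expR (- N).
Proof.
move=> x0 eta0 gam0 zeta0 P0 H1 H2 H3.
have eta1 : 0 < 1 + eta by rewrite ltr_pwDl // ltW.
have N0 : 0 <= N by rewrite ler0n.
set om := ln (1 + eta).
have omE : expR om = 1 + eta by rewrite lnK // posrE.
have om0 : 0 <= om by rewrite ln_ge0 // lerDl ltW.
pose y := expR (- beta); pose z := expR (- zeta).
(* When [#|U| <= eps * N] the factor [expR (zeta * (eps * N - #|U|))] is at least 1, so inserting it
   turns a restricted sum into a full binomial one. In [cC], one [N] of the [2 * N] pays for the
   number of sets. *)
pose cB := expR (zeta * eps * N - gam * om * N); pose cC := expR (- (2 * N)).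
have term U : P U -> (1 + #|U|%:R * x)^-1 ^+ F U <= y ^+ #|U| + (cB * z ^+ #|U| + cC * 1 ^+ #|U|).
  move=> PU; have ux0 : 0 <= #|U|%:R * x by rewrite mulr_ge0 // ltW.
  have yp : 0 <= y ^+ #|U| by rewrite exprn_ge0 // expR_ge0.
  have zp : 0 <= cB * z ^+ #|U| by rewrite mulr_ge0 ?exprn_ge0 ?expR_ge0.
  have cp : 0 <= cC * 1 ^+ #|U| by rewrite mulr_ge0 ?exprn_ge0 ?expR_ge0.
  have [ux|ux] := leP (#|U|%:R * x) eta.
    rewrite (@le_trans _ _ (y ^+ #|U|)) // ?lerDl ?addr_ge0 //.
    rewrite /y -expRM_natl mulrN.
    apply: exprV_le_expR (expR_div_le ux0 ux) _.
    have := H2 U PU ux; rewrite mulrAC ler_pdivlMr // => H.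
    by rewrite -!mulrA ler_wpM2l.
  have [Ue|Ue] := leP (#|U|%:R) (eps * N).
    rewrite (@le_trans _ _ (cB * z ^+ #|U|)) //; last by rewrite ler_wpDl // lerDl.
    rewrite /cB /z -expRM_natl -expRD.
    rewrite -[X in _ <= expR X]opprK; apply: (exprV_le_expR (r := om)).
      by rewrite omE lerD2l ltW.
    rewrite !opprD !opprK mulrN opprK addrAC.
    have A1 := ler_wpM2l om0 (H1 U PU).
    have A2 := ler_wpM2l zeta0 Ue.
    lra.
  rewrite (@le_trans _ _ (cC * 1 ^+ #|U|)) //; last by rewrite addrA ler_wpDl // addr_ge0.
  rewrite expr1n mulr1 /cC; apply: exprV_le_expR (H3 U Ue) _.
  by rewrite mulrAC ler_pdivlMr // -mulrA [N * _]mulrC ler_wpM2l // H1.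
have yb : \sum_(U | P U) y ^+ #|U| <= expR (N * y) - 1.
  apply: (@le_trans _ _ (\sum_(U : {set T} | U != finset.set0) y ^+ #|U|)).
    rewrite big_mkcond [leRHS]big_mkcond; apply: ler_sum => U _.
    case: ifP => [/P0 ->//|_]; case: ifP => // _; exact: exprn_ge0 (expR_ge0 _).
  have := sum_expr_card y; rewrite (bigD1 finset.set0) //= cards0 expr0 lerBrDl => ->.
  by rewrite expr1D_le_expR // addr_ge0 // expR_ge0.
have all_le (c u : R) : 0 <= c -> 0 <= u ->
    \sum_(U | P U) c * u ^+ #|U| <= c * expR (N * u).
  move=> c0 u0; rewrite -mulr_sumr ler_wpM2l //.
  apply: (@le_trans _ _ (\sum_(U : {set T}) u ^+ #|U|)).
    rewrite big_mkcond; apply: ler_sum => U _; case: ifP => // _; exact: exprn_ge0.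
  by rewrite sum_expr_card expr1D_le_expR // addr_ge0.
apply: (@le_trans _ _ (\sum_(U | P U) (y ^+ #|U| + (cB * z ^+ #|U| + cC * 1 ^+ #|U|)))).
  by apply: ler_sum => U; exact: term.
rewrite !big_split /= -addrA lerD // lerD //.
  apply: le_trans (all_le _ _ (expR_ge0 _) (expR_ge0 _)) _.
  rewrite -expRD ler_expR -/z; lra.
apply: le_trans (all_le _ _ (expR_ge0 _) ler01) _.
by rewrite -expRD ler_expR; lra.
Qed.

End SubsetSums.

(** * Laplace transforms and the weak law of large numbers *)

Section LaplaceTransform.
Variables (R : realType) (q : option nat -> R).
Hypotheses (q0 : forall y, 0 <= q y)
  (q1 : (\sum_(0 <= k <oo) (q (Some k))%:E = 1)%E).

Definition laplace (s : R) : R := law_mean q (fun k => expR (- (s * k%:R))).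

Lemma laplace_bound (s : R) (k : nat) : 0 <= s -> 0 <= expR (- (s * k%:R)) <= 1.
Proof. by move=> s0; rewrite expR_ge0 -[leRHS]expR0 ler_expR oppr_le0 mulr_ge0. Qed.

Lemma expRN_le (y : R) : 0 <= y -> expR (- y) <= 1 - y + y ^+ 2.
Proof.
move=> y0; have y1 : 0 < 1 + y by rewrite ltr_pwDl.
rewrite expRN (@le_trans _ _ (1 + y)^-1) ?lef_pV2 ?posrE ?expR_gt0 ?expR_ge1Dx //.
rewrite -[leLHS]mul1r ler_pdivrMr //.
have := mulr_ge0 y0 (sqr_ge0 y); nra.
Qed.

(** Truncation at [K] controls the quadratic error even if [q] has no second moment. *)
Lemma expRN_minn_le (s : R) (k K : nat) : 0 <= s ->
  expR (- (s * k%:R)) + s * (minn k K)%:R <= 1 + s ^+ 2 * K%:R ^+ 2.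
Proof.
move=> s0; set m := (minn k K)%:R.
have mk : s * m <= s * k%:R by rewrite ler_wpM2l // ler_nat geq_minl.
have m0 : 0 <= s * m by rewrite mulr_ge0.
have mK : (s * m) ^+ 2 <= (s * K%:R) ^+ 2.
  by apply: lerXn2r; rewrite ?nnegrE ?mulr_ge0 // ler_wpM2l // ler_nat geq_minr.
have e1 : expR (- (s * k%:R)) <= expR (- (s * m)) by rewrite ler_expR lerN2.
have := expRN_le m0; rewrite -exprMn; lra.
Qed.

Lemma laplace_le (s : R) (K : nat) : 0 <= s ->
  laplace s <= 1 - s * law_mean q (fun k => (minn k K)%:R) + s ^+ 2 * K%:R ^+ 2.
Proof.
move=> s0; rewrite addrAC lerBrDr.
apply: (law_mean_le_affine q0 q1 (B := 1 + K%:R)) => // [k|k||k].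
- by have /andP[-> h] := laplace_bound k s0; rewrite (le_trans h) // lerDl.
- by rewrite ler0n ler_wpDl // ler_nat geq_minr.
- by rewrite addr_ge0 // mulr_ge0 // sqr_ge0.
- exact: expRN_minn_le.
Qed.

Lemma laplace_ge (mu s : R) : 0 <= s ->
  (\sum_(0 <= k <oo) (k%:R * q (Some k))%:E = mu%:E)%E -> 1 - s * mu <= laplace s.
Proof.
move=> s0 Hmu; apply: (law_mean_ge_tangent q0 q1 s0 _ _ Hmu) => k.
  exact: laplace_bound.
exact: le_trans (expR_ge1Dx _).
Qed.

Lemma laplace_ge0 s : 0 <= laplace s.
Proof. by apply: law_mean_ge0 => // k; exact: expR_ge0. Qed.

Lemma laplace_exp_le (s : R) (K N : nat) : 0 <= s ->
  laplace s ^+ N <= expR (N%:R * (s ^+ 2 * K%:R ^+ 2 - s * law_mean q (fun k => (minn k K)%:R))).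
Proof.
move=> s0; rewrite expRM_natl; apply: lerXn2r; rewrite ?nnegrE ?laplace_ge0 ?expR_ge0 //.
apply: le_trans (laplace_le K s0) _; apply: le_trans (expR_ge1Dx _).
by rewrite -addrA [X in 1 + X]addrC.
Qed.

Lemma expR_sub_le (a b : R) : b <= a -> a <= 1 -> expR a - expR b <= expR 1 * (a - b).
Proof.
move=> ba a1.
have -> : expR a - expR b = expR a * (1 - expR (b - a)).
  by rewrite mulrBr mulr1 -expRD [a + _]addrC subrK.
have h := expR_ge1Dx (b - a).
apply: (@le_trans _ _ (expR a * (a - b))); first by rewrite ler_wpM2l ?expR_ge0 //; lra.
by rewrite ler_wpM2r ?ler_expR // subr_ge0.
Qed.

(* The left-hand side is [E (expR (- A / N) - expR (- mu)) ^+ 2], where [A] is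
   the sum of [N] independent variables of law [q]. *)
Lemma laplace_square_cvg (mu e : R) : 0 < e ->
  (\sum_(0 <= k <oo) (k%:R * q (Some k))%:E = mu%:E)%E ->
  \forall N \near \oo%classic,
    laplace (2 / N%:R) ^+ N + expR (- mu) ^+ 2 - 2 * expR (- mu) * laplace (1 / N%:R) ^+ N <= e.
Proof.
move=> e0 Hmu; set E : R := expR 1; have E0 : 0 < E by rewrite expR_gt0.
have mu0 : 0 <= mu.
  by rewrite -lee_fin -Hmu nneseries_ge0 // => k _ _; rewrite lee_fin mulr_ge0.
(* Truncation, quadratic term and lower bound cost at most five times [e / 8] in total; [E] bounds
   the derivative of [expR] below 1. *)
have [K HK] : exists K, mu - e / (8 * E) < law_mean q (fun k => (minn k K)%:R).
  apply: law_mean_min_gt => //; rewrite Hmu lte_fin ltrBlDr ltrDl.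
  by rewrite divr_gt0 // mulr_gt0.
set mK := law_mean _ _ in HK.
near=> N.
have N1 : 1 <= N%:R :> R by near: N; exact: nbhs_infty_ger.
have N0 : 0 < N%:R :> R by apply: lt_le_trans N1.
have Nm : 2 * mu + 1 <= N%:R by near: N; exact: nbhs_infty_ger.
have Nm0 : 0 < N%:R - mu by lra.
have NK1 : 4 * K%:R ^+ 2 / N%:R <= 1 :> R.
  by rewrite ler_pdivrMr // mul1r; near: N; exact: nbhs_infty_ger.
have NK2 : 4 * K%:R ^+ 2 / N%:R <= e / (8 * E).
  rewrite ler_pdivrMr // -ler_pdivrMl ?divr_gt0 ?mulr_gt0 //.
  by near: N; exact: nbhs_infty_ger.
have NM : mu ^+ 2 / (N%:R - mu) <= e / (8 * E).
  rewrite ler_pdivrMr // -ler_pdivrMl ?divr_gt0 ?mulr_gt0 // lerBrDr.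
  by near: N; exact: nbhs_infty_ger.
have b1 : expR (- mu) <= 1 by rewrite -[leRHS]expR0 ler_expR oppr_le0.
have b0 : 0 < expR (- mu) by exact: expR_gt0.
have mKmu : mK <= mu.
  rewrite -lee_fin -(law_meanE q0 q1 (B := K%:R)) => [|k]; last first.
    by rewrite ler0n ler_nat geq_minr.
  rewrite -Hmu; apply: lee_nneseries => [k _ _|k _]; rewrite lee_fin ?mulr_ge0 //.
  by rewrite mulrC ler_wpM2r // ler_nat geq_minl.
have mK0 : 0 <= mK by apply: law_mean_ge0.
have H2 : laplace (2 / N%:R) ^+ N <= expR (- (2 * mu)) + E * (2 * (mu - mK) + 4 * K%:R ^+ 2 / N%:R).
  have := laplace_exp_le K N (divr_ge0 (ler0n _ 2) (ltW N0)).
  have -> : N%:R * ((2 / N%:R) ^+ 2 * K%:R ^+ 2 - 2 / N%:R * mK) =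
     4 * K%:R ^+ 2 / N%:R - 2 * mK by field; rewrite gt_eqF.
  move=> h; apply: le_trans h _; rewrite -lerBlDl.
  have -> : 2 * (mu - mK) + 4 * K%:R ^+ 2 / N%:R =
    4 * K%:R ^+ 2 / N%:R - 2 * mK - (- (2 * mu)) by ring.
  apply: expR_sub_le; last lra.
  have : 0 <= 4 * K%:R ^+ 2 / N%:R :> R by rewrite divr_ge0 // mulr_ge0 // sqr_ge0.
  lra.
(* Uses [(1 - mu / N)^-1 = 1 + mu / (N - mu) <= expR (mu / (N - mu))], whose [N]-th power has
   exponent [mu + mu^2 / (N - mu)]. *)
have H1 : expR (- mu) - E * (mu ^+ 2 / (N%:R - mu)) <= laplace (1 / N%:R) ^+ N.
  apply: (@le_trans _ _ (expR (- (mu + mu ^+ 2 / (N%:R - mu))))).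
    rewrite lerBlDr -lerBlDl.
    set w := mu ^+ 2 / (N%:R - mu).
    have w0 : 0 <= w by rewrite divr_ge0 ?sqr_ge0 // ltW.
    apply: (@le_trans _ _ (E * (- mu - - (mu + w)))); first by apply: expR_sub_le; lra.
    by rewrite opprK addKr.
  have y1 : 0 < 1 - 1 / N%:R * mu.
    by rewrite subr_gt0 mulrC mulrA mulr1 ltr_pdivrMr // mul1r; lra.
  apply: (@le_trans _ _ ((1 - 1 / N%:R * mu) ^+ N)); last first.
    apply: lerXn2r; rewrite ?nnegrE ?laplace_ge0 ?(ltW y1) //.
    by apply: laplace_ge => //; rewrite divr_ge0.
  have -> : - (mu + mu ^+ 2 / (N%:R - mu)) = N%:R * - (mu / (N%:R - mu)).
    by field; rewrite gt_eqF.
  rewrite expRM_natl; apply: lerXn2r; rewrite ?nnegrE ?expR_ge0 ?(ltW y1) //.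
  rewrite expRN -[leRHS]invrK lef_pV2 ?posrE ?expR_gt0 ?invr_gt0 //.
  apply: le_trans (expR_ge1Dx _); rewrite le_eqVlt; apply/orP; left; apply/eqP.
  by field; rewrite !gt_eqF //=; lra.
have -> : expR (- mu) ^+ 2 = expR (- (2 * mu)) by rewrite -expRM_natl mulrN.
have H1' := ler_wpM2l (ltW b0) H1.
have Ee : E * (e / (8 * E)) = e / 8 by field; rewrite gt_eqF.
have M1 := ler_wpM2l (ltW E0) (ltW HK).
have M2 := ler_wpM2l (ltW E0) NK2.
have M3 := ler_wpM2l (ltW E0) NM.
have M4 : expR (- mu) * (E * (mu ^+ 2 / (N%:R - mu))) <= e / 8.
  apply: le_trans (_ : E * (mu ^+ 2 / (N%:R - mu)) <= _); last by rewrite -Ee.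
  by rewrite ler_piMl // mulr_ge0 ?(ltW E0) // divr_ge0 ?sqr_ge0 ?(ltW Nm0).
have b2 : expR (- (2 * mu)) = expR (- mu) * expR (- mu) by rewrite -expRD; congr expR; ring.
move: H1' H2 M1 M2 M4; rewrite mulrBr mulrBr Ee b2 !mulrDr; lra.
Unshelve. all: by end_near.
Qed.

End LaplaceTransform.

(** * The subcritical case *)

Section Subcritical.
Variable R : realType.
Implicit Types (alpha C e : R).

Lemma near_infty_S (P : nat -> Prop) :
  (\forall n \near \oo%classic, P n) -> \forall n \near \oo%classic, P n.+1.
Proof. by case=> m _ H; exists m => // n /= mn; apply: H => /=; exact: leqW. Qed.

Lemma near_ln_ge (A : R) : \forall n \near \oo%classic, A <= ln n.+1%:R.
Proof.
near=> n.
have nA : expR A <= n%:R by near: n; exact: nbhs_infty_ger.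
rewrite -(expRK A) ler_ln ?posrE ?expR_gt0 ?ltr0n //.
by apply: le_trans nA _; rewrite ler_nat.
Unshelve. all: by end_near.
Qed.

Lemma p_seq_ge0 alpha n : 0 <= p_seq alpha n.
Proof. by rewrite /p_seq le_max lexx. Qed.

Lemma p_seq_lt1 alpha n : 0 < alpha -> 0 < ln (n%:R : R) -> p_seq alpha n < 1.
Proof. by move=> a0 l0; rewrite /p_seq gt_max ltr01 gtrBl divr_gt0. Qed.

(** If the positive part vanishes the rate is 0; otherwise [1 - p = alpha / ln N] and the factor
    [p <= 1] is dropped. *)
Lemma hit_rate_p_seq_le alpha n N : 0 < alpha -> (0 < n)%N -> 0 < ln (N%:R : R) ->
  hit_rate n (p_seq alpha N) <= ln N%:R / (alpha * n%:R).
Proof.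
move=> a0 n0 l0; have n0' : 0 < n%:R :> R by rewrite ltr0n.
rewrite /hit_rate /p_seq; set L := ln _ in l0 *.
case: (leP (1 - alpha / L) 0) => p0.
  by rewrite mul0r divr_ge0 ?mulr_ge0 // ltW.
have -> : (1 - alpha / L) / (n%:R * (1 - (1 - alpha / L))) = (1 - alpha / L) * (L / (alpha * n%:R)).
  by field; rewrite !gt_eqF.
rewrite ler_piMl ?divr_ge0 ?mulr_ge0 ?(ltW a0) ?(ltW l0) //.
by rewrite gerBl divr_ge0 // ltW.
Qed.

Lemma expR_ge_cube (L : R) : 0 <= L -> L ^+ 3 / 6 <= expR L.
Proof. by move=> /(expR_ge1Dxn 2) h; apply: le_trans h; rewrite lerDr. Qed.

(** With [k] midway between [C / alpha] and 1, eventually [M x <= k ln (n + 1)], so [(1 + x) ^+ M]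
    is at most [(n + 1)] to the power [k < 1], negligible against [n]; and [M x^2] tends to 0. *)
Lemma cover_prob_small alpha C e : 0 <= C -> C < alpha -> 0 < e ->
  \forall n \near \oo%classic, forall f : {ffun 'I_n.+1 -> nat},
    (\sum_v f v)%N%:R <= C * n.+1%:R -> cover_prob (p_seq alpha n.+1) f <= e.
Proof.
move=> C0 Ca e0; have a0 : 0 < alpha by lra.
pose k := (C / alpha + 1) / 2.
have Ca1 : C / alpha < 1 by rewrite ltr_pdivrMr // mul1r.
have Ca0 : 0 <= C / alpha by rewrite divr_ge0 // ltW.
have k1 : 0 < 1 - k by rewrite /k; lra.
have kC : 0 < k * alpha - C.
  have -> : k * alpha - C = (alpha - C) / 2 by rewrite /k; field; rewrite gt_eqF.
  by rewrite divr_gt0 // subr_gt0.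
have k0 : 0 < k by rewrite /k; lra.
pose w := ln (1 + e / 2).
have w0 : 0 < w by rewrite ln_gt0 // ltrDl divr_gt0.
near=> n => f fC.
have L1 : 1 <= ln n.+1%:R :> R by near: n; exact: near_ln_ge.
have L2 : 12 * k / (alpha * w) <= ln n.+1%:R by near: n; exact: near_ln_ge.
have L3 : 4 / e / (1 - k) <= ln n.+1%:R by near: n; exact: near_ln_ge.
have n1 : 1 <= n%:R :> R by near: n; exact: nbhs_infty_ger.
have n2 : (C + 1) / (k * alpha - C) <= n%:R by near: n; exact: nbhs_infty_ger.
have NE : expR (ln n.+1%:R) = n.+1%:R :> R by rewrite lnK // posrE ltr0n.
have n0 : (0 < n)%N by rewrite -(ltr0n R); lra.
have n0' : 0 < n%:R :> R by lra.
set L := ln _ in L1 L2 L3 NE.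
have L0 : 0 < L by lra.
have p1 := p_seq_lt1 a0 L0.
have p0 := p_seq_ge0 alpha n.+1.
have xL := hit_rate_p_seq_le a0 n0 L0; rewrite -/L in xL.
apply: le_trans (cover_prob_le f n0 p0 p1) _.
set x := hit_rate _ _ in xL *.
have x0 : 0 <= x by apply: hit_rate_ge0.
have SN : n.+1%:R = n%:R + 1 :> R by rewrite -natr1.
set M := (1 + _)%N.
have M1 : M%:R <= k * alpha * n%:R.
  rewrite /M natrD; apply: le_trans (lerD (lexx _) fC) _.
  rewrite ler_pdivrMr // in n2; rewrite SN; lra.
have Mx : M%:R * x <= k * L.
  apply: (@le_trans _ _ (k * alpha * n%:R * (L / (alpha * n%:R)))).
    by apply: ler_pM.
  by rewrite le_eqVlt; apply/orP; left; apply/eqP; field; rewrite !gt_eqF.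
(* Since [n + 1 = expR L], [n] outgrows the [L^2] in the bound on [M * x ^+ 2]. *)
have n3 : L ^+ 3 / 12 <= n%:R.
  have := expR_ge_cube (ltW L0); rewrite NE SN; lra.
have Mx2 : M%:R * x ^+ 2 <= w.
  rewrite expr2 mulrA; apply: (@le_trans _ _ (k * L * (L / (alpha * n%:R)))).
    by apply: ler_pM => //; rewrite mulr_ge0.
  have -> : k * L * (L / (alpha * n%:R)) = k * L ^+ 2 / alpha / n%:R by field; rewrite !gt_eqF.
  rewrite ler_pdivrMr //; apply: le_trans (ler_wpM2l (ltW w0) n3).
  have -> : w * (L ^+ 3 / 12) = (alpha * w / 12 * L) * (L ^+ 2 / alpha) by field; rewrite gt_eqF.
  rewrite -mulrA ler_wpM2r ?divr_ge0 ?sqr_ge0 ?(ltW a0) //.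
  rewrite ler_pdivrMr ?mulr_gt0 // in L2; lra.
have E1 : (1 + x ^+ 2) ^+ M - 1 <= e / 2.
  rewrite lerBlDl; apply: le_trans (expr1D_le_expR _ _) _; first by rewrite addr_ge0 // sqr_ge0.
  have we : expR w = 1 + e / 2 by rewrite lnK // posrE addr_gt0 // divr_gt0.
  by rewrite -we ler_expR.
have E2 : (1 + x) ^+ M / n%:R <= e / 2.
  rewrite ler_pdivrMr //; apply: le_trans (expr1D_le_expR _ _) _; first by rewrite addr_ge0.
  apply: (@le_trans _ _ (expR (k * L))); first by rewrite ler_expR.
  have -> : k * L = L + - ((1 - k) * L) by ring.
  rewrite expRD expRN ler_pdivrMr ?expR_gt0 // NE.
  have e4 : 4 <= e * expR ((1 - k) * L).
    rewrite mulrC -ler_pdivrMr //; apply: le_trans (expR_ge1Dx _).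
    rewrite ler_pdivrMr // in L3; lra.
  apply: (@le_trans _ _ (n%:R * 2)); first by rewrite SN; lra.
  have -> : e / 2 * n%:R * expR ((1 - k) * L) = n%:R * (e * expR ((1 - k) * L) / 2) by ring.
  by rewrite ler_wpM2l // ler_pdivlMr //; lra.
lra.
Unshelve. all: by end_near.
Qed.

Lemma prod_expR (N : nat) (s : R) (f : {ffun 'I_N -> nat}) :
  \prod_v expR (- (s * (f v)%:R)) = expR (- (s * (\sum_v f v)%N%:R)).
Proof.
by rewrite natr_sum mulr_sumr -sumrN expR_sum.
Qed.

(** Chebyshev for [y = expR (- A / N)], [A] being the total number of particles: if [A > C N] then
    [D (y - b)^2 >= 1], otherwise [cover_prob_small] applies. *)
Lemma all_visited_cvg0 (q : option nat -> R) alpha mu :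
  (forall y, 0 <= q y) -> q None = 0 ->
  (\sum_(0 <= k <oo) (q (Some k))%:E = 1)%E ->
  (\sum_(0 <= k <oo) (k%:R * q (Some k))%:E = mu%:E)%E -> mu < alpha ->
  (all_visited_prob q n (p_seq alpha n) @[n --> \oo] --> (0 : R^o))%classic.
Proof.
move=> q0 qN q1 Hmu mua.
have mu0 : 0 <= mu.
  by rewrite -lee_fin -Hmu nneseries_ge0 // => k _ _; rewrite lee_fin mulr_ge0.
have a0 : 0 < alpha by lra.
pose C := (mu + alpha) / 2.
pose b := expR (- mu); pose d := expR (- mu) - expR (- C).
have d0 : 0 < d by rewrite subr_gt0 ltr_expR ltrN2 /C; lra.
pose D := (d ^+ 2)^-1.
have D0 : 0 < D by rewrite invr_gt0 exprn_gt0.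
rewrite -cvg_shiftS; apply/cvgrPdist_le => e e0.
near=> n.
have L0 : 0 < ln n.+1%:R :> R.
  by apply: (@lt_le_trans _ _ 1) => //; near: n; exact: near_ln_ge.
have p1 := p_seq_lt1 a0 L0.
have p0 := p_seq_ge0 alpha n.+1.
have n0 : (0 < n)%N by near: n; exact: nbhs_infty_gt.
rewrite sub0r normrN ger0_norm; last exact: all_visited_ge0.
have cov : forall f : {ffun 'I_n.+1 -> nat},
    (\sum_v f v)%N%:R <= C * n.+1%:R -> cover_prob (p_seq alpha n.+1) f <= e / 2.
  near: n; apply: cover_prob_small; rewrite ?divr_gt0 // /C; lra.
have lap : laplace q (2 / n.+1%:R) ^+ n.+1 + b ^+ 2 - 2 * b * laplace q (1 / n.+1%:R) ^+ n.+1 <=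
    e / (2 * D).
  near: n; apply: (near_infty_S (P := fun N => laplace q (2 / N%:R) ^+ N + b ^+ 2 -
     2 * b * laplace q (1 / N%:R) ^+ N <= e / (2 * D))).
  by apply: laplace_square_cvg => //; rewrite divr_gt0 // mulr_gt0.
set N := n.+1 in lap *.
have N0 : 0 < N%:R :> R by rewrite ltr0n.
have b0 : 0 < b by exact: expR_gt0.
(* The coefficients expand [D (y - b)^2], with the cross term moved to the left; both powers of [y]
   are products over the vertices. *)
have := @all_visited_le R q n (p_seq alpha n.+1) q0 qN q1 n0 p0 p1 (2 * b * D) D (e / 2 + D * b ^+ 2)
  (fun k => expR (- (1 / N%:R * k%:R))) (fun k => expR (- (2 / N%:R * k%:R))).
rewrite -/(laplace q _) -/(laplace q _) => /(_ _ _ _ _ _ _) H.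
have {}H : all_visited_prob_S q n (p_seq alpha n.+1) + 2 * b * D * laplace q (1 / N%:R) ^+ n.+1 <=
   D * laplace q (2 / N%:R) ^+ n.+1 + (e / 2 + D * b ^+ 2).
  apply: H.
  - by rewrite !mulr_ge0 // ltW.
  - exact: ltW.
  - by rewrite addr_ge0 ?divr_ge0 ?mulr_ge0 ?sqr_ge0 // ltW.
  - by move=> k; apply: laplace_bound; rewrite divr_ge0.
  - by move=> k; apply: laplace_bound; rewrite divr_ge0.
  move=> f; rewrite !prod_expR; set A := (\sum_v f v)%N.
  have -> : expR (- (2 / N%:R * A%:R)) = expR (- (1 / N%:R * A%:R)) ^+ 2 :> R.
    by rewrite -expRM_natl; congr expR; field; rewrite gt_eqF.
  set y := expR _.
  have sq : 0 <= D * (y - b) ^+ 2 by rewrite mulr_ge0 ?sqr_ge0 // ltW.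
  have [AC|AC] := leP (A%:R) (C * N%:R).
    have := cov f AC; move: sq; nra.
  have c1 := cover_prob_le1 f n0 p0 p1.
  have yd : d <= b - y.
    rewrite lerD2l lerN2 ler_expR lerN2 mulrAC ler_pdivlMr // mul1r.
    exact: ltW.
  have : 1 <= D * (y - b) ^+ 2.
    rewrite mulrC ler_pdivlMr ?exprn_gt0 // mul1r -[(y - b) ^+ 2]sqrrN opprB.
    have d0' := ltW d0; by apply: lerXn2r; rewrite ?nnegrE ?(le_trans d0' yd).
  lra.
have := ler_wpM2l (ltW D0) lap.
have -> : D * (e / (2 * D)) = e / 2 by field; rewrite gt_eqF.
rewrite /=; lra.
Unshelve. all: by end_near.
Qed.

End Subcritical.

(** * The supercritical case *)

Section Supercritical.
Variable R : realType.
Implicit Types (alpha m e : R).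

Lemma expRN_le_inv (y : R) : 0 < y -> expR (- y) <= y^-1.
Proof.
move=> y0; rewrite expRN lef_pV2 ?posrE ?expR_gt0 //.
by apply: le_trans (expR_ge1Dx _); rewrite lerDr.
Qed.

Lemma expRN_le_inv_of (y c : R) : 0 < c -> c^-1 <= y -> expR (- y) <= c.
Proof.
move=> c0 cy; have y0 : 0 < y by apply: lt_le_trans cy; rewrite invr_gt0.
by apply: le_trans (expRN_le_inv y0) _; rewrite -[leRHS]invrK lef_pV2 ?posrE ?invr_gt0.
Qed.

Lemma sum_minn_le_fertile n (f : {ffun 'I_n.+1 -> nat}) (K : nat) :
  (\sum_v minn (f v) K <= K * #|fertile f [set: 'I_n.+1]%SET|)%N.
Proof.
rewrite mulnC -sum_nat_const [leqRHS]big_mkcond; apply: leq_sum => v _.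
by rewrite !inE; case: (f v) => [|k]; rewrite ?min0n // geq_minr.
Qed.

Lemma sum_minn_le n (f : {ffun 'I_n.+1 -> nat}) (K : nat) (U : {set 'I_n.+1}) :
  (\sum_v minn (f v) K <= #|U| * K + \sum_(v | v \notin U) f v)%N.
Proof.
rewrite (bigID (mem U)) /= -sum_nat_const.
by apply: leq_add; apply: leq_sum => v _; rewrite ?geq_minr ?geq_minl.
Qed.

Lemma card_fertileC_le n (f : {ffun 'I_n.+1 -> nat}) (U : {set 'I_n.+1}) :
  (#|fertile f (~: U)%SET| <= \sum_(v | v \notin U) f v)%N.
Proof.
rewrite -sum1_card big_mkcond [leqRHS]big_mkcond; apply: leq_sum => v _.
by rewrite !inE; case: (v \in U) => //=; case: (f v).
Qed.

(** For small [U] the exponent is about [(m / alpha) ln n], which beats the cost [ln n] of choosing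
    each vertex of [U]. Early extinction has probability at most [th], of order [1 / ln n]. *)
Lemma cover_prob_large alpha m e (K : nat) : 0 < alpha -> alpha < m -> (0 < K)%N -> 0 < e ->
  \forall n \near \oo%classic, forall f : {ffun 'I_n.+1 -> nat},
    m * n.+1%:R <= (\sum_v minn (f v) K)%N%:R ->
    1 <= cover_prob (p_seq alpha n.+1) f + e.
Proof.
move=> a0 am K0 e0.
have K0' : 0 < K%:R :> R by rewrite ltr0n.
have m0 : 0 < m by lra.
(* At least [2 * gam * n.+1] vertices are fertile: half serve as threshold, and the other half keep
   the rate of finding new ones at least [gam]. *)
pose gam := m / (2 * K%:R); have gam0 : 0 < gam by rewrite divr_gt0 // mulr_gt0.
pose r := m / alpha; have r1 : 1 < r by rewrite ltr_pdivlMr // mul1r.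
have r0 : 0 < r by lra.
(* Chosen so that [(1 - k) * r] exceeds [1 + 3 * k], hence also [(1 + k) ^+ 2]; the slack [s] pays
   for the particles inside [U]. *)
pose k := (r - 1) / (4 * r).
have r4 : 0 < 4 * r by rewrite mulr_gt0.
have r1' : 0 < r - 1 by rewrite subr_gt0.
have k0 : 0 < k by rewrite divr_gt0 ?subr_gt0 // mulr_gt0.
have k1 : k < 1.
  by rewrite /k ltr_pdivrMr // mul1r; lra.
pose s := (1 - k) * r - (1 + 3 * k).
have s0 : 0 < s.
  have -> : s = 3 * (r - 1) ^+ 2 / (4 * r) by rewrite /s /k; field; rewrite gt_eqF.
  by rewrite divr_gt0 // mulr_gt0 // exprn_gt0.
pose om := ln (1 + k); have om0 : 0 < om by rewrite ln_gt0 // ltrDl.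
(* [zeta * eps] and the bound [zeta^-1] on [expR (- zeta)] both equal [gam * om / 4], leaving a rate
   [gam * om / 2]. *)
pose zeta := 4 / (gam * om).
have zeta0 : 0 < zeta by rewrite divr_gt0 // mulr_gt0.
pose eps := gam * om / (4 * zeta).
have eps0 : 0 < eps by apply: divr_gt0; apply: mulr_gt0.
pose w := ln (1 + e / 4); have w0 : 0 < w by rewrite ln_gt0 // ltrDl divr_gt0.
near=> n => f fm.
have L1 : 1 <= ln n.+1%:R :> R by near: n; exact: near_ln_ge.
have L2 : alpha / k <= ln n.+1%:R by near: n; exact: near_ln_ge.
have L3 : 2 * alpha <= ln n.+1%:R by near: n; exact: near_ln_ge.
have L4 : 8 * alpha / gam <= ln n.+1%:R by near: n; exact: near_ln_ge.
have L5 : 16 * alpha / (gam * e) <= ln n.+1%:R by near: n; exact: near_ln_ge.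
have L6 : K%:R * k / s <= ln n.+1%:R by near: n; exact: near_ln_ge.
have L7 : expR (2 / gam) / (eps * (1 - k) / alpha) <= ln n.+1%:R by near: n; exact: near_ln_ge.
have L8 : 1 / w / k <= ln n.+1%:R by near: n; exact: near_ln_ge.
have n1 : 1 <= n%:R :> R by near: n; exact: nbhs_infty_ger.
have n2 : 4 / e <= n%:R by near: n; exact: nbhs_infty_ger.
have n3 : 4 / e / (gam * om / 2) <= n%:R by near: n; exact: nbhs_infty_ger.
have NE : expR (ln n.+1%:R) = n.+1%:R :> R by rewrite lnK // posrE ltr0n.
have n0 : (0 < n)%N by rewrite -(ltr0n R); lra.
set L := ln _ in L1 L2 L3 L4 L5 L6 L7 L8 NE.
have L0 : 0 < L by lra.
have n0' : 0 < n%:R :> R by lra.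
have nN : n%:R <= n.+1%:R :> R by rewrite ler_nat.
have N0 : 0 < n.+1%:R :> R by rewrite ltr0n.
pose del := alpha / L.
have del0 : 0 < del by rewrite divr_gt0.
have del1 : del <= 1 / 2 by rewrite ler_pdivrMr //; lra.
have delk : del <= k by rewrite ler_pdivrMr // mulrC -ler_pdivrMr.
have pE : p_seq alpha n.+1 = 1 - del.
  by rewrite /p_seq -/L -/del; apply/max_idPr; rewrite subr_ge0; lra.
have p1 := p_seq_lt1 a0 L0.
have p0 := p_seq_ge0 alpha n.+1.
(* The drift gains at least [th * gam / 4], which for this [th] is exactly the death probability
   [del]. *)
pose th := 4 * del / gam.
have th0 : 0 < th by rewrite divr_gt0 // mulr_gt0.
have th1 : th <= 1 / 2.
  rewrite /th ler_pdivrMr // /del mulrA ler_pdivrMr //.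
  rewrite ler_pdivrMr // in L4; lra.
have the : th <= e / 4.
  rewrite /th ler_pdivrMr // /del mulrA ler_pdivrMr //.
  have ge0 : 0 < gam * e by rewrite mulr_gt0.
  rewrite ler_pdivrMr // in L5; lra.
have thg : th * gam = 4 * del by rewrite /th; field; rewrite gt_eqF.
set x := hit_rate n (p_seq alpha n.+1).
have xE : x = (1 - del) * L / alpha / n%:R.
  by rewrite /x /hit_rate pE /del; field; rewrite !gt_eqF.
have x0 : 0 < x.
  by rewrite xE !divr_gt0 ?mulr_gt0 //; lra.
have xN : (1 - k) * L / alpha <= x * n.+1%:R.
  apply: (@le_trans _ _ (x * n%:R)); last by rewrite ler_wpM2l // ltW.
  have La : 0 <= L / alpha by rewrite divr_ge0 ?(ltW L0) // ltW.
  rewrite xE mulfVK ?gt_eqF // -!mulrA ler_wpM2r //; lra.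
have fert : gam * n.+1%:R + gam * n%:R <= #|fertile f [set: 'I_n.+1]%SET|%:R.
  apply: (@le_trans _ _ (2 * gam * n.+1%:R)).
    by have := ler_wpM2l (ltW gam0) nN; lra.
  have -> : 2 * gam * n.+1%:R = m * n.+1%:R / K%:R by rewrite /gam; field; rewrite gt_eqF.
  rewrite ler_pdivrMr //; apply: le_trans fm _.
  by rewrite mulrC -natrM ler_nat sum_minn_le_fertile.
have drift : 1 - p_seq alpha n.+1 + p_seq alpha n.+1 * th * (1 - gam * (1 - th)) <= th.
  rewrite pE; have := mulr_ge0 (ltW del0) (ltW th0).
  have h : 1 / 4 <= (1 - del) * (1 - th) by nra.
  have := ler_wpM2l (ltW del0) h; nra.
have := cover_prob_ge n0 p0 p1 th0 (le_trans th1 _) fert drift.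
have h1 : (1 / 2 : R) <= 1 by lra.
move=> /(_ h1); rewrite lerBlDl -/x => cov.
apply: le_trans cov _; rewrite lerD2l.
pose P (U : {set 'I_n.+1}) := (U != finset.set0) && (gam * n.+1%:R <= #|fertile f (~: U)%SET|%:R).
have := @sum_escape_le R 'I_n.+1 P (fun U => \sum_(v | v \notin U) f v)%N x k gam eps
  ((1 + k) * L) zeta x0 k0 gam0 (ltW zeta0).
rewrite card_ord => /(_ _ _ _ _) sum_le.
apply: (@le_trans _ _ (e / 4 + (e / 4 + e / 4 + e / 4))); last lra.
rewrite lerD //; apply: le_trans (sum_le _ _ _ _) _.
- by move=> U /andP[].
- move=> U /andP[_ /le_trans]; apply; rewrite ler_nat; exact: card_fertileC_le.
- move=> U _ Uk.
  have := sum_minn_le f K U; rewrite -(ler_nat R) natrD natrM => Ff.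
  have {Ff} := ler_wpM2l (ltW x0) (le_trans fm Ff).
  have h2 : (1 - k) * r * L <= x * (m * n.+1%:R).
    have := ler_wpM2l (ltW m0) xN.
    have -> : m * ((1 - k) * L / alpha) = (1 - k) * r * L by rewrite /r; field; rewrite gt_eqF.
    lra.
  have h3 : K%:R * (#|U|%:R * x) <= K%:R * k by rewrite ler_wpM2l.
  have h4 : K%:R * k <= s * L by rewrite [leRHS]mulrC -ler_pdivrMr.
  have h5 : (1 + k) * L * (1 + k) <= (1 + 3 * k) * L.
    have : k * k * L <= k * L.
      by rewrite ler_wpM2r ?(ltW L0) // ler_piMl ?(ltW k0) // ltW.
    lra.
  rewrite mulrDr /s in h4 *; lra.
- move=> U Ue; rewrite ler_wpDl //.
  have ek : 0 < eps * (1 - k) / alpha.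
    by rewrite divr_gt0 // mulr_gt0 // subr_gt0.
  rewrite ler_pdivrMr // in L7; apply: le_trans L7 _.
  apply: (@le_trans _ _ (eps * (x * n.+1%:R))).
    have := ler_wpM2l (ltW eps0) xN; lra.
  by have := ler_wpM2r (ltW x0) (ltW Ue); lra.
rewrite lerD // ?lerD //.
- have -> : n.+1%:R * expR (- ((1 + k) * L)) = expR (- (k * L)).
    by rewrite -NE -expRD; congr expR; ring.
  have we : expR w = 1 + e / 4 by rewrite lnK // posrE addr_gt0 // divr_gt0.
  rewrite lerBlDl -we ler_expR.
  by apply: expRN_le_inv_of => //; rewrite mulrC -ler_pdivrMr // -[w^-1]mul1r.
- have zE : expR (- zeta) <= gam * om / 4.
    apply: le_trans (expRN_le_inv zeta0) _; rewrite le_eqVlt; apply/orP; left; apply/eqP.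
    by rewrite /zeta; field; rewrite !gt_eqF.
  have ze : zeta * eps = gam * om / 4 by rewrite /eps; field; rewrite gt_eqF.
  apply: (@le_trans _ _ (expR (- (n.+1%:R * (gam * om / 2))))).
    by rewrite ler_expR lerN2 ler_wpM2l // ze -/om; lra.
  have go : 0 < gam * om / 2 by rewrite divr_gt0 // mulr_gt0.
  apply: expRN_le_inv_of; first by rewrite divr_gt0.
  by rewrite invf_div -ler_pdivrMr //; apply: le_trans n3 nN.
- apply: expRN_le_inv_of; first by rewrite divr_gt0.
  by rewrite invf_div; apply: le_trans n2 nN.
Unshelve. all: by end_near.
Qed.

(** A Chernoff bound for the counts truncated at [K] makes the hypothesis of [cover_prob_large] fail
    with exponentially small probability; [m] lies midway between [alpha] and the truncated mean. *)
Lemma all_visited_cvg1 (q : option nat -> R) alpha :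
  (forall y, 0 <= q y) -> q None = 0 ->
  (\sum_(0 <= k <oo) (q (Some k))%:E = 1)%E -> 0 < alpha ->
  (alpha%:E < \sum_(0 <= k <oo) (k%:R * q (Some k))%:E)%E ->
  (all_visited_prob q n (p_seq alpha n) @[n --> \oo] --> (1 : R^o))%classic.
Proof.
move=> q0 qN q1 a0 amu.
have [K aK] := law_mean_min_gt q0 q1 amu.
set mK := law_mean _ _ in aK.
have minb k : (0 : R) <= (minn k K)%:R <= (K%:R : R) by rewrite ler0n ler_nat geq_minr.
have mKK : mK <= K%:R.
  have := law_mean_le_affine q0 q1 (g := fun=> 0) (h := fun k => (minn k K)%:R)
    (B := K%:R) (c := 1) (d := K%:R).
  move=> H.
  have g0 : 0 <= law_mean q (fun=> 0) by apply: law_mean_ge0.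
  have {}H : law_mean q (fun=> 0) + 1 * mK <= K%:R.
    by apply: H => // k; rewrite ?lexx ?ler0n // add0r mul1r; case/andP: (minb k).
  lra.
have K0 : (0 < K)%N by rewrite -(ltr0n R); lra.
pose m := (alpha + mK) / 2.
(* So small that the quadratic term takes at most half of the linear gain [s * (mK - m)]; the other
   half is the rate [t]. *)
pose s := (mK - m) / (2 * (K%:R ^+ 2 + 1)).
have K2 : 0 < K%:R ^+ 2 + 1 :> R by rewrite ltr_wpDl // sqr_ge0.
have mm : 0 < mK - m by rewrite /m; lra.
have s0 : 0 < s by rewrite divr_gt0 // mulr_gt0.
have sK : s * K%:R ^+ 2 <= (mK - m) / 2.
  have <- : s * (K%:R ^+ 2 + 1) = (mK - m) / 2 by rewrite /s; field; rewrite gt_eqF.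
  by rewrite ler_wpM2l ?lerDl // ltW.
pose t := s * (mK - m) / 2; have t0 : 0 < t by rewrite divr_gt0 // mulr_gt0.
pose g k := expR (- (s * (minn k K)%:R)).
have gb k : 0 <= g k <= 1 by apply: laplace_bound; exact: ltW.
have gA : law_mean q g <= 1 + (s ^+ 2 * K%:R ^+ 2 - s * mK).
  rewrite addrA lerBrDr.
  apply: (law_mean_le_affine q0 q1 (B := 1 + K%:R)) => [k|k|||k].
  - by have /andP[-> h] := gb k; rewrite (le_trans h) // lerDl.
  - by have /andP[-> h] := minb k; rewrite (le_trans h) // lerDr.
  - exact: ltW.
  - by rewrite addr_ge0 // mulr_ge0 // sqr_ge0.
  - by have := expRN_minn_le (minn k K) K (ltW s0); rewrite -minnA minnn.
rewrite -cvg_shiftS; apply/cvgrPdist_le => e e0.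
near=> n.
have L0 : 0 < ln n.+1%:R :> R.
  by apply: (@lt_le_trans _ _ 1) => //; near: n; exact: near_ln_ge.
have p1 := p_seq_lt1 a0 L0.
have p0 := p_seq_ge0 alpha n.+1.
have n0 : (0 < n)%N by near: n; exact: nbhs_infty_gt.
have N0 : 0 < n.+1%:R :> R by rewrite ltr0n.
have nt : 2 / e / t <= n%:R by near: n; exact: nbhs_infty_ger.
rewrite ger0_norm; last by rewrite subr_ge0; exact: all_visited_le1.
have cov : forall f : {ffun 'I_n.+1 -> nat},
    m * n.+1%:R <= (\sum_v minn (f v) K)%N%:R ->
    1 <= cover_prob (p_seq alpha n.+1) f + e / 2.
  near: n; apply: cover_prob_large => //; rewrite ?divr_gt0 // /m; lra.
(* Normalizes the Chernoff factor: [c * \prod_v g (f v)] is at least 1 when the truncated total is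
   below [m * n.+1]. *)
pose c := expR (s * m * n.+1%:R).
have H : 1 <= all_visited_prob_S q n (p_seq alpha n.+1) + (c * law_mean q g ^+ n.+1 + e / 2).
  apply: all_visited_ge => //; first exact: expR_ge0.
    by rewrite divr_ge0 // ltW.
  move=> f.
  have gE : \prod_v g (f v) = expR (- (s * (\sum_v minn (f v) K)%N%:R)).
    by rewrite natr_sum mulr_sumr -sumrN expR_sum.
  have cg : 0 <= c * \prod_v g (f v) by rewrite gE mulr_ge0 ?expR_ge0.
  have [mf|mf] := leP (m * n.+1%:R) (\sum_v minn (f v) K)%N%:R.
    by have := cov f mf; lra.
  have : 1 <= c * \prod_v g (f v).
    rewrite gE -expRD -[leLHS]expR0 ler_expR.
    have := ler_wpM2l (ltW s0) (ltW mf); lra.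
  have := cover_prob_ge0 f n0 p0 p1; lra.
have cA : c * law_mean q g ^+ n.+1 <= e / 2.
  apply: (@le_trans _ _ (expR (- (n.+1%:R * t)))).
    apply: (@le_trans _ _ (c * expR (n.+1%:R * (s ^+ 2 * K%:R ^+ 2 - s * mK)))).
      rewrite ler_wpM2l ?expR_ge0 // expRM_natl; apply: lerXn2r.
      - by rewrite nnegrE; apply: law_mean_ge0 => // k; case/andP: (gb k).
      - by rewrite nnegrE expR_ge0.
      - exact: le_trans gA (expR_ge1Dx _).
    rewrite -expRD ler_expR.
    have := ler_wpM2l (ltW N0) (ler_wpM2l (ltW s0) sK); rewrite /t; lra.
  apply: expRN_le_inv_of; first by rewrite divr_gt0.
  rewrite invf_div -ler_pdivrMr //; apply: le_trans nt _.
  by rewrite ler_nat.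
rewrite /=; lra.
Unshelve. all: by end_near.
Qed.

End Supercritical.

(** * Both regimes combined *)

Local Open Scope classical_set_scope.

Theorem theorem1p2 (R : realType) (q : option nat -> R) (alpha : R) :
  is_eta_law q -> q (Some 0%N) < 1 -> 0 < alpha ->
  ((alpha%:E > eta_mean q)%E ->
     all_visited_prob q n (p_seq alpha n) @[n --> \oo] --> 0) /\
  ((alpha%:E < eta_mean q)%E ->
     all_visited_prob q n (p_seq alpha n) @[n --> \oo] --> (1 : R^o)).
Proof.
move=> [q0 q1] _ a0; rewrite /eta_mean.
(* If [eta] can be infinite, the mean is infinite and full coverage holds by convention. *)
have [qN|qN] := ltP 0 (q None).
  split=> [|_]; first by rewrite ltNge leey.
  have -> : (fun n => all_visited_prob q n (p_seq alpha n)) = fun=> 1.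
    by apply/funext => -[//|n]; rewrite /= /all_visited_prob_S qN.
  exact: cvg_cst.
have {}qN : q None = 0 by apply/eqP; rewrite eq_le qN q0.
rewrite qN add0e in q1.
split=> Halpha; last exact: all_visited_cvg1.
set mean := (X in (X < _)%E) in Halpha.
have mean0 : (0 <= mean)%E.
  by apply: nneseries_ge0 => k _ _; rewrite lee_fin mulr_ge0.
have meanE : mean = (fine mean)%:E.
  by rewrite fineK // ge0_fin_numE // (lt_trans Halpha) // ltry.
apply: (all_visited_cvg0 q0 qN q1 meanE).
by rewrite -lte_fin -meanE.
Qed.
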